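(* Let $\mathbb{F}$ be any field with algebraic closure $\overline{\mathbb{F}}$, and let $\ell,m\ge1$ be integers. There are the following isomorphisms of $\mathrm{GL}_2(\mathbb{F})$-representations: (1) $\big(\mathrm{Sym}_{\ell m}(\mathbb{F}^{\ell\times\ell\times2})\big)_{\mathrm{SL}_\ell(\overline{\mathbb{F}})\times\mathrm{SL}_\ell(\overline{\mathbb{F}})}\ \cong\ \mathrm{Sym}_m\,\mathrm{Sym}^\ell(\mathbb{F}^2)$; (2) $\big(\mathrm{Sym}_{\ell m}(\mathbb{F}^{\ell\times\ell\times2})\big)_{\mathrm{SL}_\ell(\overline{\mathbb{F}})\times\mathrm{SL}_\ell(\overline{\mathbb{F}})}\ \cong\ \big(\mathrm{Sym}^{\ell m}(\mathbb{F}^{m\times m\times2})\big)^{\mathrm{SL}_m(\overline{\mathbb{F}})\times\mathrm{SL}_m(\overline{\mathbb{F}})}$.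
   Context: For $n\ge1$ write $\mathbb{F}^{n\times n\times 2}:=\mathbb{F}^n\otimes\mathbb{F}^n\otimes\mathbb{F}^2$, and similarly over $\overline{\mathbb{F}}$; fix the embedding $\mathbb{F}\subseteq\overline{\mathbb{F}}$, so that the tensor, symmetric and divided powers over $\mathbb{F}$ are contained in those over $\overline{\mathbb{F}}$. Here $\mathrm{Sym}^d$ denotes the $d$-th symmetric power, and $\mathrm{Sym}_d W=(\bigotimes^d W)^{\mathfrak{S}_d}$ denotes the $d$-th divided power (space of symmetric tensors). The group $\mathrm{GL}_n(\overline{\mathbb{F}})\times\mathrm{GL}_n(\overline{\mathbb{F}})\times\mathrm{GL}_2(\overline{\mathbb{F}})$ acts $\overline{\mathbb{F}}$-linearly on $\overline{\mathbb{F}}^{n\times n\times2}$ by $(g_1,g_2,g_3)(v_1\otimes v_2\otimes v_3)=g_1v_1\otimes g_2v_2\otimes g_3v_3$, and hence on $\mathrm{Sym}^d(\overline{\mathbb{F}}^{n\times n\times2})$ and $\mathrm{Sym}_d(\overline{\mathbb{F}}^{n\times n\times2})$. The group $Z_n:=\mathrm{SL}_n(\overline{\mathbb{F}})\times\mathrm{SL}_n(\overline{\mathbb{F}})$ acts through the first two factors, and $\mathrm{GL}_2(\mathbb{F})$ acts through the third factor. Invariants: $\big(\mathrm{Sym}^d(\mathbb{F}^{n\times n\times2})\big)^{Z_n}:=\big(\mathrm{Sym}^d(\overline{\mathbb{F}}^{n\times n\times2})\big)^{Z_n}\cap\mathrm{Sym}^d(\mathbb{F}^{n\times n\times2})$.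 Coinvariants: let $W=\mathrm{Sym}_d(\overline{\mathbb{F}}^{n\times n\times2})$, let $I=\langle zw-w\mid z\in Z_n,\,w\in W\rangle_{\overline{\mathbb{F}}}$ and $W_{Z_n}=W/I$. Then $\big(\mathrm{Sym}_d(\mathbb{F}^{n\times n\times2})\big)_{Z_n}$ is defined to be the $\mathbb{F}$-subspace of $W/I$ consisting of those cosets $v+I$ that contain a representative $v\in\mathrm{Sym}_d(\mathbb{F}^{n\times n\times2})$. Both spaces are $\mathrm{GL}_2(\mathbb{F})$-representations over $\mathbb{F}$ via the induced actions. The action on $\mathrm{Sym}_m\mathrm{Sym}^\ell(\mathbb{F}^2)$ is induced from the standard action on $\mathbb{F}^2$. *)

(* Defs.v *)
From HB Require Import structures.
From mathcomp Require Import all_boot all_order all_algebra.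
From mathcomp Require Import perm generic_quotient ring_quotient.
From mathcomp.classical Require Import boolp.
From mathcomp.real_closed Require Import mxtens.
From mathcomp.multinomials Require Import mpoly.

Set Implicit Arguments.
Unset Strict Implicit.
Unset Printing Implicit Defensive.

Import GRing.Theory.
Local Open Scope ring_scope.
Local Open Scope quotient_scope.

(* Only the values of [ract] at invertible matrices are meaningful. *)
Record glrep (F : fieldType) (n : nat) := GLRep {
  rcarrier :> lmodType F;
  ract : 'M[F]_n -> rcarrier -> rcarrier;
  ract_linear : forall g, g \in unitmx -> linear (ract g);
  ract1 : forall v, ract 1%:M v = v;
  ractM : forall g h v, g \in unitmx -> h \in unitmx ->
    ract (g *m h) v = ract g (ract h v) }.

Definition glrep_iso (F : fieldType) (n : nat) (U V : glrep F n) : Prop :=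
  exists f : {linear U -> V}, bijective f /\
    forall g, g \in unitmx -> forall u, f (ract g u) = ract g (f u).

Section SubQuotient.
Variables (R : fieldType) (V : lmodType R).

Record subm (S : submodClosed V) := Subm { subm_val :> V; _ : subm_val \in S }.
HB.instance Definition _ (S : submodClosed V) := [isSub for @subm_val S].
HB.instance Definition _ (S : submodClosed V) := [Choice of subm S by <:].
HB.instance Definition _ (S : submodClosed V) :=
  [SubChoice_isSubLmodule of subm S by <:].

Inductive lspan_prop (X : V -> Prop) : V -> Prop :=
| lspan0 : lspan_prop X 0
| lspanD c x v : X x -> lspan_prop X v -> lspan_prop X (c *: x + v).

Definition lspan (X : V -> Prop) : {pred V} := [pred v | `[< lspan_prop X v >]].

Lemma lspan_submod_closed X : submod_closed (lspan X).
Proof.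
split=> [|c u v]; first exact/asboolP/lspan0.
move=> /asboolP su /asboolP sv; apply/asboolP.
elim: su => [|b x w Xx _ ih]; first by rewrite scaler0 add0r.
by rewrite scalerDr scalerA -addrA; apply: lspanD.
Qed.
HB.instance Definition _ X := GRing.isSubmodClosed.Build R V (lspan X)
  (lspan_submod_closed X).

Definition lquot (X : V -> Prop) := Quotient.quot (lspan X).
HB.instance Definition _ X := GRing.Zmodule.on (lquot X).

Section Lquot.
Variable X : V -> Prop.

Definition lpi (v : V) : lquot X := \pi_(Quotient.quot (lspan X)) v.
Definition lrepr (x : lquot X) : V := repr (x : Quotient.quot (lspan X)).

Lemma lreprK : cancel lrepr lpi. Proof. exact: reprK. Qed.

Lemma lpiP u v : (lpi u = lpi v) <-> (u - v \in lspan X).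
Proof. by rewrite (Quotient.idealrBE (lspan X) u v); split=> [/eqP|/eqP]. Qed.

Lemma lpiD u v : lpi (u + v) = lpi u + lpi v. Proof. exact: raddfD. Qed.

Definition lquot_scale (c : R) (x : lquot X) : lquot X := lpi (c *: lrepr x).

Lemma lquot_scaleE c v : lquot_scale c (lpi v) = lpi (c *: v).
Proof. by apply/lpiP; rewrite -scalerBr rpredZ //; apply/lpiP/lreprK. Qed.

Lemma lquot_scaleA a b x : lquot_scale a (lquot_scale b x) = lquot_scale (a * b) x.
Proof. by rewrite -[x]lreprK !lquot_scaleE scalerA. Qed.
Lemma lquot_scale1 x : lquot_scale 1 x = x.
Proof. by rewrite -[x]lreprK lquot_scaleE scale1r. Qed.
Lemma lquot_scaleDr c : {morph lquot_scale c : x y / x + y}.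
Proof.
by move=> x y; rewrite -[x]lreprK -[y]lreprK -lpiD !lquot_scaleE scalerDr lpiD.
Qed.
Lemma lquot_scaleDl x : {morph lquot_scale^~ x : a b / a + b}.
Proof. by move=> a b; rewrite -[x]lreprK !lquot_scaleE scalerDl lpiD. Qed.

HB.instance Definition _ := GRing.Zmodule_isLmodule.Build R (lquot X)
  lquot_scaleA lquot_scale1 lquot_scaleDr lquot_scaleDl.

Lemma lpi_is_linear : linear lpi.
Proof. by move=> c u v; rewrite lpiD -lquot_scaleE. Qed.
HB.instance Definition _ := GRing.isLinear.Build R V (lquot X) _ lpi
  lpi_is_linear.

End Lquot.
End SubQuotient.

(* [V] seen as an [F]-vector space along [iota]. *)
Definition rscal (F K : fieldType) (iota : {rmorphism F -> K}) (V : lmodType K)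
  : Type := V.

Section RestrictScalars.
Variables (F K : fieldType) (iota : {rmorphism F -> K}) (V : lmodType K).
HB.instance Definition _ := GRing.Zmodule.on (rscal iota V).

Definition rscal_scale (c : F) (x : rscal iota V) : rscal iota V :=
  iota c *: (x : V).

Lemma rscal_scaleA a b x : rscal_scale a (rscal_scale b x) = rscal_scale (a * b) x.
Proof. by rewrite /rscal_scale rmorphM scalerA. Qed.
Lemma rscal_scale1 x : rscal_scale 1 x = x.
Proof. by rewrite /rscal_scale rmorph1 scale1r. Qed.
Lemma rscal_scaleDr c : {morph rscal_scale c : x y / x + y}.
Proof. by move=> x y; rewrite /rscal_scale -scalerDr. Qed.
Lemma rscal_scaleDl x : {morph rscal_scale^~ x : a b / a + b}.
Proof. by move=> a b; rewrite /rscal_scale rmorphD scalerDl. Qed.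

HB.instance Definition _ := GRing.Zmodule_isLmodule.Build F (rscal iota V)
  rscal_scaleA rscal_scale1 rscal_scaleDr rscal_scaleDl.
End RestrictScalars.

Section TensorPower.
Variables (I : finType) (d : nat).

(* [T a] is the coefficient of [e_(a 0) (x) ... (x) e_(a (d-1))] in an element of
   the d-th tensor power of the space with basis [(e_i)_(i : I)]. *)
Definition tens (R : fieldType) := {ffun {ffun 'I_d -> I} -> R^o}.

Definition tens_perm (R : fieldType) (s : 'S_d) (T : tens R) : tens R :=
  [ffun a : {ffun 'I_d -> I} => T [ffun k => a (s k)]].

Definition symtens (R : fieldType) : {pred tens R} :=
  [pred T | [forall s : 'S_d, tens_perm s T == T]].
Arguments symtens R : clear implicits.

Lemma symtensP (R : fieldType) (T : tens R) :
  reflect (forall s, tens_perm s T = T) (T \in symtens R).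
Proof. exact: 'forall_eqP. Qed.

Lemma symtens_submod_closed (R : fieldType) : submod_closed (symtens R).
Proof.
split=> [|c T U /symtensP sT /symtensP sU]; apply/symtensP=> s.
  by apply/ffunP=> a; rewrite !ffunE.
by apply/ffunP=> a; rewrite -[in RHS](sT s) -[in RHS](sU s) !ffunE.
Qed.
HB.instance Definition _ (R : fieldType) :=
  GRing.isSubmodClosed.Build R (tens R) (symtens R)
    (@symtens_submod_closed R).

Definition divpow (R : fieldType) := subm (symtens R).
HB.instance Definition _ (R : fieldType) := GRing.Lmodule.on (divpow R).

Section Map.
Variable R : fieldType.
Implicit Types (A B : I -> I -> R) (T U : tens R).

(* [A i j] is the coefficient of [e_i] in the image of [e_j]. *)
Definition tens_map A T : tens R :=
  [ffun a : {ffun 'I_d -> I} =>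
    \sum_(b : {ffun 'I_d -> I}) (\prod_k A (a k) (b k)) * T b].

Lemma tens_map_sym A T : T \in symtens R -> tens_map A T \in symtens R.
Proof.
move=> /symtensP sT; apply/symtensP=> s; apply/ffunP=> a; rewrite !ffunE.
pose h (t : 'S_d) (b : {ffun 'I_d -> I}) := [ffun k => b (t k)] : {ffun 'I_d -> I}.
have hK : cancel (h s) (h s^-1%g).
  by move=> b; apply/ffunP=> k; rewrite !ffunE permKV.
have hK' : cancel (h s^-1%g) (h s).
  by move=> b; apply/ffunP=> k; rewrite !ffunE permK.
rewrite (reindex (h s)); last by exists (h s^-1%g) => b _; rewrite ?hK ?hK'.
apply: eq_bigr => b _; congr (_ * _); last by rewrite -[in RHS](sT s) ffunE.
rewrite [RHS](reindex_inj (@perm_inj _ s)) /=.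
by apply: eq_bigr => k _; rewrite !ffunE.
Qed.

Lemma tens_map_linear A : linear (tens_map A).
Proof.
move=> c T U; apply/ffunP=> a; rewrite !ffunE scaler_sumr -big_split /=.
by apply: eq_bigr => b _; rewrite !ffunE mulrDr scalerAr.
Qed.

Lemma tens_map1 T : tens_map (fun i j => (i == j)%:R) T = T.
Proof.
apply/ffunP=> a; rewrite ffunE (bigD1 a) //= big1 ?mul1r; last first.
  by move=> k _; rewrite eqxx.
rewrite big1 ?addr0 // => b ba.
have [k ak] : exists k, a k != b k.
  apply/existsP; rewrite -negb_forall; apply: contra ba => /forallP ab.
  by apply/eqP/ffunP=> k; apply/esym/eqP.
by rewrite (bigD1 k) //= (negbTE ak) !mul0r.
Qed.

Lemma tens_mapM A B T :
  tens_map (fun i j => \sum_k A i k * B k j) T = tens_map A (tens_map B T).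
Proof.
apply/ffunP=> a; rewrite !ffunE.
under [RHS]eq_bigr => c _ do rewrite ffunE mulr_sumr.
rewrite exchange_big /=; apply: eq_bigr => b _.
rewrite bigA_distr_bigA mulr_suml; apply: eq_bigr => c _.
by rewrite big_split mulrA.
Qed.

Lemma eq_tens_map A B T : A =2 B -> tens_map A T = tens_map B T.
Proof.
move=> AB; apply/ffunP=> a; rewrite !ffunE; apply: eq_bigr => b _.
by congr (_ * _); apply: eq_bigr => k _; rewrite AB.
Qed.

Definition divpow_map A (T : divpow R) : divpow R :=
  Subm (tens_map_sym A (valP T)).

Lemma divpow_map_linear A : linear (divpow_map A).
Proof. by move=> c T U; apply/val_inj; exact: tens_map_linear. Qed.

Lemma divpow_map1 A (T : divpow R) : (A =2 fun i j => (i == j)%:R) -> divpow_map A T = T.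
Proof.
by move=> A1; apply/val_inj; rewrite /= (eq_tens_map _ A1) tens_map1.
Qed.

Lemma divpow_mapM A B C (T : divpow R) : (C =2 fun i j => \sum_k A i k * B k j) ->
  divpow_map C T = divpow_map A (divpow_map B T).
Proof.
by move=> AB; apply/val_inj; rewrite /= (eq_tens_map _ AB) tens_mapM.
Qed.
End Map.

Section Embedding.
Variables (F K : fieldType) (iota : {rmorphism F -> K}).

Definition tens_emb (T : tens F) : tens K := [ffun a => iota (T a)].

Lemma tens_emb_sym T : T \in symtens F -> tens_emb T \in symtens K.
Proof.
move=> /symtensP sT; apply/symtensP=> s.
by apply/ffunP=> a; rewrite -[in RHS](sT s) !ffunE.
Qed.

Definition divpow_emb (T : divpow F) : divpow K :=
  Subm (tens_emb_sym (valP T)).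

Lemma divpow_embD c T U :
  divpow_emb (c *: T + U) = iota c *: divpow_emb T + divpow_emb U.
Proof. by apply/val_inj/ffunP=> a; rewrite !ffunE rmorphD rmorphM. Qed.

Lemma divpow_emb_map (A : I -> I -> F) T :
  divpow_emb (divpow_map A T) =
  divpow_map (fun i j => iota (A i j)) (divpow_emb T).
Proof.
apply/val_inj/ffunP=> a; rewrite !ffunE rmorph_sum; apply: eq_bigr => b _.
by rewrite !ffunE rmorphM rmorph_prod.
Qed.
End Embedding.
End TensorPower.
Arguments symtens I d R : clear implicits.

Section SymmetricPower.
Variables (N d : nat).

(* The symmetric algebra of [R^N] is the polynomial ring whose variables are the
   basis vectors of [R^N]. *)
Definition sympow (R : fieldType) := dhomog N R d.
HB.instance Definition _ (R : fieldType) := GRing.Lmodule.on (sympow R).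

Section Map.
Variable R : fieldType.
Implicit Types (A B : 'M[R]_N) (p q : {mpoly R[N]}).

(* The algebra endomorphism sending the basis vector ['X_j] to its image under
   [A]. *)
Definition mpoly_map A p : {mpoly R[N]} :=
  p \mPo [tuple \sum_i A i j *: 'X_i | j < N].

Lemma mpoly_mapXU A j : mpoly_map A 'X_j = \sum_i A i j *: 'X_i.
Proof. by rewrite /mpoly_map comp_mpolyXU nth_mktuple. Qed.

Lemma mpoly_mapX A (m : 'X_{1..N}) :
  mpoly_map A 'X_[m] = \prod_j (\sum_i A i j *: 'X_i) ^+ m j.
Proof.
by rewrite /mpoly_map comp_mpolyX; apply: eq_bigr => j _; rewrite tnth_mktuple.
Qed.

Lemma mpoly_map_homog A p : p \is d.-homog -> mpoly_map A p \is d.-homog.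
Proof.
move=> hp; rewrite [p]mpolyE /mpoly_map raddf_sum big_seq /=.
apply: rpred_sum => m mp; rewrite comp_mpolyZ; apply: dhomogZ.
rewrite -/(mpoly_map A _) mpoly_mapX.
have <- : mdeg m = d by have /dhomogP := hp; apply.
rewrite mdegE.
elim/big_rec2: _ => [|j q k _ hq]; first exact: dhomog1.
apply: dhomogM hq; rewrite -[X in X.-homog]mul1n; apply: dhomogMn.
by apply: rpred_sum => i _; apply: dhomogZ; rewrite dhomogX /= mdeg1.
Qed.

Lemma mpoly_map_linear A : linear (mpoly_map A).
Proof. by move=> c p q; rewrite /mpoly_map linearP. Qed.
HB.instance Definition _ A := GRing.isLinear.Build R {mpoly R[N]} {mpoly R[N]}
  _ (mpoly_map A) (mpoly_map_linear A).

Lemma mpoly_map1 p : mpoly_map 1%:M p = p.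
Proof.
rewrite -[RHS]comp_mpoly_id /mpoly_map; congr comp_mpoly.
apply/eq_from_tnth=> j; rewrite !tnth_mktuple (bigD1 j) //= mxE eqxx scale1r.
by rewrite big1 ?addr0 // => i /negbTE ij; rewrite mxE ij scale0r.
Qed.

Lemma mpoly_mapM A B p : mpoly_map (A *m B) p = mpoly_map A (mpoly_map B p).
Proof.
rewrite [p]mpolyE (linear_sum (mpoly_map _)) (linear_sum (mpoly_map B)).
rewrite (linear_sum (mpoly_map A)); apply: eq_bigr => m _.
rewrite !linearZ /=; congr (_ *: _); rewrite !mpoly_mapX.
rewrite /(mpoly_map A) rmorph_prod; apply: eq_bigr => j _.
rewrite rmorphXn /=; congr (_ ^+ _); rewrite -/(mpoly_map A _) linear_sum /=.
under [RHS]eq_bigr => i _ do rewrite linearZ /= mpoly_mapXU scaler_sumr.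
rewrite exchange_big; apply: eq_bigr => i _ /=.
rewrite mxE scaler_suml; apply: eq_bigr => k _.
by rewrite scalerA mulrC.
Qed.

Definition sympow_map A (p : sympow R) : sympow R :=
  DHomog (mpoly_map_homog A (valP p)).

Lemma sympow_map_linear A : linear (sympow_map A).
Proof. by move=> c p q; apply/val_inj; exact: mpoly_map_linear. Qed.

Lemma sympow_map1 (p : sympow R) : sympow_map 1%:M p = p.
Proof. by apply/val_inj; exact: mpoly_map1. Qed.

Lemma sympow_mapM A B (p : sympow R) :
  sympow_map (A *m B) p = sympow_map A (sympow_map B p).
Proof. by apply/val_inj; exact: mpoly_mapM. Qed.

(* The monomials of degree [d], a basis of [sympow R]. *)
Definition monom := {m : 'X_{1..N < d.+1} | mdeg m == d}.

(* The matrix of [sympow_map A] in the basis of monomials. *)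
Definition sympow_mx A (a b : monom) : R :=
  (mpoly_map A 'X_[val b])@_(val a).

Lemma sympow_mx1 : sympow_mx 1%:M =2 fun a b => (a == b)%:R.
Proof.
move=> a b; rewrite /sympow_mx mpoly_map1 mcoeffX.
by rewrite [in RHS]eq_sym -!val_eqE.
Qed.

Lemma homog_monomE p : p \is d.-homog ->
  p = \sum_(c : monom) p@_(val c) *: 'X_[val c].
Proof.
move=> hp; apply/mpolyP=> m; rewrite raddf_sum /=.
under eq_bigr => c _ do rewrite mcoeffZ mcoeffX.
have [md|md] := eqVneq (mdeg m) d; last first.
  rewrite (dhomog_nemf_coeff hp md) big1 // => c _.
  have [cm|] := eqVneq; last by rewrite mulr0.
  by rewrite -cm (eqP (valP c)) eqxx in md.
have md' : (mdeg m < d.+1)%N by rewrite md.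
have mdd : mdeg (BMultinom md') == d by apply/eqP.
rewrite (bigD1 (exist _ (BMultinom md') mdd)) //= eqxx mulr1 big1 ?addr0 // => c.
by rewrite -!val_eqE /= => /negbTE ->; rewrite mulr0.
Qed.

Lemma sympow_mxM A B :
  sympow_mx (A *m B) =2 fun a b => \sum_c sympow_mx A a c * sympow_mx B c b.
Proof.
move=> a b; rewrite /sympow_mx mpoly_mapM.
have hB : mpoly_map B 'X_[val b] \is d.-homog.
  by apply: mpoly_map_homog; rewrite dhomogX; exact: valP b.
rewrite {1}(homog_monomE hB).
rewrite (linear_sum (mpoly_map A)) raddf_sum /=; apply: eq_bigr => c _.
by rewrite linearZ mcoeffZ mulrC.
Qed.
End Map.

Section Embedding.
Variables (F K : fieldType) (iota : {rmorphism F -> K}).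

Lemma map_mpoly_homog (p : {mpoly F[N]}) :
  p \is d.-homog -> map_mpoly iota p \is d.-homog.
Proof.
move=> /dhomogP hp; apply/dhomogP=> m.
by rewrite (perm_mem (msupp_map_mpoly _ (fmorph_inj iota))); exact: hp.
Qed.

Definition sympow_emb (p : sympow F) : sympow K :=
  DHomog (map_mpoly_homog (valP p)).

Lemma sympow_embD c p q :
  sympow_emb (c *: p + q) = iota c *: sympow_emb p + sympow_emb q.
Proof. by apply/val_inj; rewrite /= raddfD /= map_mpolyZ. Qed.

Lemma sympow_emb_map (A : 'M[F]_N) p :
  sympow_emb (sympow_map A p) = sympow_map (map_mx iota A) (sympow_emb p).
Proof.
apply/val_inj; rewrite /= /mpoly_map map_mpoly_comp; last exact: fmorph_inj.
congr comp_mpoly; apply/eq_from_tnth=> j.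
rewrite tnth_map !tnth_mktuple raddf_sum; apply: eq_bigr => i _ /=.
by rewrite map_mpolyZ map_mpolyX mxE.
Qed.
End Embedding.
End SymmetricPower.

Section SymSym.
Variables (F : fieldType) (m l : nat).

Let I := monom 2 l.

(* Divided power of the space with basis [monom 2 l], i.e. of the l-th symmetric
   power of [F^2]. *)
Definition symsym_act (g : 'M[F]_2) : divpow I m F -> divpow I m F :=
  divpow_map (@sympow_mx 2 l F g).

Lemma symsym_act_linear g : g \in unitmx -> linear (symsym_act g).
Proof. by move=> _; exact: divpow_map_linear. Qed.

Lemma symsym_act1 v : symsym_act 1%:M v = v.
Proof. by apply: divpow_map1; exact: sympow_mx1. Qed.

Lemma symsym_actM g h v : g \in unitmx -> h \in unitmx ->
  symsym_act (g *m h) v = symsym_act g (symsym_act h v).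
Proof. by move=> _ _; apply: divpow_mapM; exact: sympow_mxM. Qed.

Definition symsym_rep : glrep F 2 :=
  GLRep symsym_act_linear symsym_act1 symsym_actM.
End SymSym.

(* [R^n (x) R^n (x) R^2] is [R^(n * n * 2)], on which [(z1, z2, g)] acts by the
   Kronecker product. *)
Definition kron3 (R : fieldType) (n : nat) (z1 z2 : 'M[R]_n) (g : 'M[R]_2) :
  'M[R]_(n * n * 2) := tensmx (tensmx z1 z2) g.

Section Kron3.
Variables (R : fieldType) (n : nat).
Implicit Types (x y : 'M[R]_n) (g h : 'M[R]_2).

Lemma kron3M x1 x2 g y1 y2 h :
  kron3 x1 x2 g *m kron3 y1 y2 h = kron3 (x1 *m y1) (x2 *m y2) (g *m h).
Proof. by rewrite /kron3 !tensmx_mul. Qed.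

Lemma tensmx11 (p q : nat) : tensmx 1%:M 1%:M = 1%:M :> 'M[R]_(p * q).
Proof.
apply/matrixP=> i j.
case: (mxtens_indexP i) => i1 i2; case: (mxtens_indexP j) => j1 j2.
rewrite tensmxE !mxE (can_eq (@mxtens_indexK p q)) xpair_eqE.
by rewrite -natrM mulnb.
Qed.

Lemma kron3_1 : kron3 1%:M 1%:M 1%:M = 1%:M :> 'M[R]_(n * n * 2).
Proof. by rewrite /kron3 !tensmx11. Qed.

Lemma kron3_comm x1 x2 g :
  kron3 1%:M 1%:M g *m kron3 x1 x2 1%:M = kron3 x1 x2 1%:M *m kron3 1%:M 1%:M g.
Proof. by rewrite !kron3M !mul1mx !mulmx1. Qed.
End Kron3.

Lemma map_kron3 (F K : fieldType) (iota : {rmorphism F -> K}) n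
    (z1 z2 : 'M[F]_n) g :
  map_mx iota (kron3 z1 z2 g) =
  kron3 (map_mx iota z1) (map_mx iota z2) (map_mx iota g).
Proof. by rewrite /kron3 !map_mxT. Qed.

Section Coinvariants.
Variables (F K : fieldType) (iota : {rmorphism F -> K}) (n d : nat).

Local Notation W R := (divpow 'I_(n * n * 2) d R).

Definition div_act (R : fieldType) (z1 z2 : 'M[R]_n) (g : 'M[R]_2) :
  W R -> W R := divpow_map (kron3 z1 z2 g).

Lemma div_act_linear (R : fieldType) (z1 z2 : 'M[R]_n) g :
  linear (div_act z1 z2 g).
Proof. exact: divpow_map_linear. Qed.
HB.instance Definition _ (R : fieldType) (z1 z2 : 'M[R]_n) (g : 'M[R]_2) :=
  GRing.isLinear.Build R (W R) (W R) _ (div_act z1 z2 g)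
    (div_act_linear z1 z2 g).

Lemma div_actM (R : fieldType) (x1 x2 y1 y2 : 'M[R]_n) g h w :
  div_act (x1 *m y1) (x2 *m y2) (g *m h) w =
  div_act x1 x2 g (div_act y1 y2 h w).
Proof. by apply: divpow_mapM => i j; rewrite -kron3M mxE. Qed.

Lemma div_act1 (R : fieldType) (w : W R) : div_act 1%:M 1%:M 1%:M w = w.
Proof. by apply: divpow_map1 => i j; rewrite kron3_1 mxE. Qed.

Lemma div_act_emb (z1 z2 : 'M[F]_n) g w :
  divpow_emb iota (div_act z1 z2 g w) =
  div_act (map_mx iota z1) (map_mx iota z2) (map_mx iota g) (divpow_emb iota w).
Proof.
rewrite /div_act divpow_emb_map; apply/val_inj/eq_tens_map => i j.
by rewrite -map_kron3 [RHS]mxE.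
Qed.

Definition coinv_rel (x : W K) : Prop :=
  exists z1 z2 : 'M[K]_n, exists w : W K,
    [/\ \det z1 = 1, \det z2 = 1 & x = div_act z1 z2 1%:M w - w].

Definition coinvK := lquot coinv_rel.
HB.instance Definition _ := GRing.Lmodule.on coinvK.

Definition coinvK_act (g : 'M[K]_2) (x : coinvK) : coinvK :=
  lpi coinv_rel (div_act 1%:M 1%:M g (lrepr x)).

Lemma coinvK_actE g w :
  coinvK_act g (lpi coinv_rel w) = lpi coinv_rel (div_act 1%:M 1%:M g w).
Proof.
apply/lpiP; rewrite -linearB /=.
have : lrepr (lpi coinv_rel w) - w \in lspan coinv_rel by apply/lpiP/lreprK.
move: (_ - w) => v /asboolP sv; apply/asboolP.
elim: sv => [|c x u [z1 [z2 [y [h1 h2 ->]]]] _ ih].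
  by rewrite linear0; exact: lspan0.
rewrite linearP; apply: lspanD ih.
exists z1, z2, (div_act 1%:M 1%:M g y); split=> //.
by rewrite linearB /= -!div_actM !mul1mx !mulmx1.
Qed.

Lemma coinvK_act_linear g : linear (coinvK_act g).
Proof.
move=> c x y; rewrite -[x]lreprK -[y]lreprK -linearP !coinvK_actE.
by rewrite !linearP.
Qed.

(* The classes that have a representative with coordinates in [F]. *)
Definition coinvF : {pred rscal iota coinvK} :=
  [pred x | `[< exists v : W F, x = lpi coinv_rel (divpow_emb iota v) >]].

Lemma coinvF_submod_closed : submod_closed coinvF.
Proof.
split=> [|c x y /asboolP [u ->] /asboolP [v ->]]; apply/asboolP.
  exists 0; have -> : divpow_emb iota 0 = 0 :> W K; last by rewrite linear0.
  by apply/val_inj/ffunP=> a; rewrite !ffunE rmorph0.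
by exists (c *: u + v); rewrite divpow_embD linearP.
Qed.
HB.instance Definition _ :=
  GRing.isSubmodClosed.Build F (rscal iota coinvK) coinvF coinvF_submod_closed.

Definition coinv := subm coinvF.
HB.instance Definition _ := GRing.Lmodule.on coinv.

Lemma coinvF_act g x : x \in coinvF -> coinvK_act (map_mx iota g) x \in coinvF.
Proof.
move=> /asboolP [v ->]; apply/asboolP; exists (div_act 1%:M 1%:M g v).
by rewrite coinvK_actE div_act_emb !map_mx1.
Qed.

Definition coinv_act (g : 'M[F]_2) (x : coinv) : coinv :=
  Subm (coinvF_act g (valP x)).

Lemma coinv_act_linear g : g \in unitmx -> linear (coinv_act g).
Proof.
move=> _ c x y; apply/val_inj.
exact: (coinvK_act_linear (map_mx iota g) (iota c) (subm_val x) (subm_val y)).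
Qed.

Lemma coinv_act1 x : coinv_act 1%:M x = x.
Proof.
apply/val_inj; rewrite /= -[subm_val x]lreprK coinvK_actE map_mx1.
by rewrite div_act1.
Qed.

Lemma coinv_actM g h x : g \in unitmx -> h \in unitmx ->
  coinv_act (g *m h) x = coinv_act g (coinv_act h x).
Proof.
move=> _ _; apply/val_inj; rewrite /= -[subm_val x]lreprK !coinvK_actE map_mxM.
by rewrite -div_actM !mul1mx.
Qed.

Definition coinv_rep : glrep F 2 :=
  GLRep coinv_act_linear coinv_act1 coinv_actM.
End Coinvariants.

Section Invariants.
Variables (F K : fieldType) (iota : {rmorphism F -> K}) (n d : nat).

Local Notation S R := (sympow (n * n * 2) d R).

Definition sym_act (R : fieldType) (z1 z2 : 'M[R]_n) (g : 'M[R]_2) :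
  S R -> S R := sympow_map (kron3 z1 z2 g).

Definition invarF : {pred S F} :=
  [pred p | `[< forall z1 z2 : 'M[K]_n, \det z1 = 1 -> \det z2 = 1 ->
    sym_act z1 z2 1%:M (sympow_emb iota p) = sympow_emb iota p >]].

Lemma invarF_submod_closed : submod_closed invarF.
Proof.
split=> [|c p q /asboolP hp /asboolP hq]; apply/asboolP=> z1 z2 h1 h2.
  apply/val_inj; rewrite /= raddf0; exact: (linear0 (mpoly_map _)).
rewrite sympow_embD [LHS]sympow_map_linear.
by congr (_ *: _ + _); [exact: hp | exact: hq].
Qed.
HB.instance Definition _ :=
  GRing.isSubmodClosed.Build F (S F) invarF invarF_submod_closed.

Definition invar := subm invarF.
HB.instance Definition _ := GRing.Lmodule.on invar.

Lemma invarF_act g p : p \in invarF -> sym_act 1%:M 1%:M g p \in invarF.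
Proof.
move=> /asboolP hp; apply/asboolP=> z1 z2 h1 h2.
rewrite /sym_act sympow_emb_map map_kron3 !map_mx1 -sympow_mapM -kron3_comm.
by rewrite sympow_mapM; congr sympow_map; exact: hp.
Qed.

Definition invar_act (g : 'M[F]_2) (p : invar) : invar := Subm (invarF_act g (valP p)).

Lemma invar_act_linear g : g \in unitmx -> linear (invar_act g).
Proof. by move=> _ c p q; apply/val_inj; exact: sympow_map_linear. Qed.

Lemma invar_act1 p : invar_act 1%:M p = p.
Proof. by apply/val_inj; rewrite /= /sym_act kron3_1 sympow_map1. Qed.

Lemma invar_actM g h p : g \in unitmx -> h \in unitmx ->
  invar_act (g *m h) p = invar_act g (invar_act h p).
Proof.
move=> _ _; apply/val_inj; rewrite /= /sym_act -sympow_mapM kron3M.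
by rewrite !mul1mx.
Qed.

Definition invar_rep : glrep F 2 := GLRep invar_act_linear invar_act1 invar_actM.
End Invariants.

(* Main.v *)
(* Both representations are isomorphic to [Sym_m Sym^l], the space of symmetric
   polynomials in [m] pairs of variables that are homogeneous of degree [l] in each
   pair.

   A polynomial of degree [n * k] on pairs [X] of [n x n] matrices which is
   invariant under [SL_n x SL_n] is determined by its restriction to diagonal
   pairs: if [X 0] is invertible, then [X] can be moved to a pair of triangular
   matrices, and a triangular pair degenerates to its diagonal under a torus. The
   restriction is symmetric, and homogeneous of degree [k] in each diagonal
   position. Among the invariants are the products of [k] coefficients of the binary
   form [det (s0 X0 + s1 X1)]. These products are linearly independent, even on
   diagonal pairs, because every binary form with nonzero leading coefficient is a
   product of linear forms. Their number is ['C(n + k, n)], the dimension of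
   [Sym_n Sym^k], so they form a basis of the invariants, and restriction to the
   diagonal is an isomorphism onto [Sym_n Sym^k]. Taking [n = m] and [k = l] gives
   the invariants.

   For the coinvariants, pair [Sym_d] of the space of pairs with the polynomials of
   degree [d = l * m] on it, and send a symmetric tensor to its pairings with the
   products of [m] coefficients of [det (s0 X0 + s1 X1)], here with [n = l]. A
   functional that kills the relations [z w - w] is the pairing with an invariant
   polynomial, hence with a combination of these products; so the kernel of this map
   is the span of the relations. *)
From HB Require Import structures.
Require Import Defs.
From mathcomp Require Import all_boot all_order all_algebra.
From mathcomp Require Import perm.
From mathcomp.classical Require Import boolp.
From mathcomp.real_closed Require Import mxtens.
From mathcomp.multinomials Require Import mpoly.

Set Implicit Arguments.
Unset Strict Implicit.
Unset Printing Implicit Defensive.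

Import GRing.Theory.
Local Open Scope ring_scope.

(** * Polynomials determined by their values, and one-parameter limits *)

Section Evaluation.
Variables (K : closedFieldType) (n : nat).
Implicit Types (p : {mpoly K[n]}) (v : 'I_n -> K) (w : 'I_n -> nat).

(** The product [q * 'X] vanishes at 0 as well, and a nonzero polynomial over an algebraically
    closed field has a nonroot. *)
Lemma poly_eq0_off0 (q : {poly K}) : (forall t, t != 0 -> q.[t] = 0) -> q = 0.
Proof.
move=> q0; have : q * 'X = 0.
  apply/eqP; apply: contraT => /closed_nonrootP [t].
  rewrite /root hornerM hornerX mulf_eq0 negb_or => /andP [qt t0].
  by rewrite q0 ?eqxx in qt.
by move/eqP; rewrite mulf_eq0 polyX_eq0 orbF => /eqP.
Qed.

Definition weight w (m : 'X_{1..n}) := (\sum_i w i * m i)%N.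

(** The restriction of [p] to the curve with coordinates [t ^+ w i * v i], as a polynomial in [t];
    its coefficients are the weight components of [p] at [v]. *)
Definition scale_poly p w v : {poly K} :=
  \sum_(m <- msupp p) (p@_m * \prod_i v i ^+ m i) *: 'X^(weight w m).

Lemma horner_scale_poly p w v t :
  (scale_poly p w v).[t] = p.@[fun i => t ^+ w i * v i].
Proof.
rewrite horner_sum mevalE; apply: eq_bigr => m _.
rewrite hornerZ hornerXn -mulrA; congr (_ * _).
under [RHS]eq_bigr => i _ do rewrite exprMn -exprM.
by rewrite big_split /= mulrC; congr (_ * _); rewrite expr_sum.
Qed.

Lemma coef_scale_poly p w v e : (scale_poly p w v)`_e =
  \sum_(m <- msupp p | weight w m == e) p@_m * \prod_i v i ^+ m i.
Proof.
rewrite coef_sum [RHS]big_mkcond; apply: eq_bigr => m _ /=.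
by rewrite coefZ coefXn eq_sym; case: eqP; rewrite ?mulr1 ?mulr0.
Qed.

(** A polynomial in [t] that is constant off 0 is constant. At [t = 0] the coordinates of weight 0
    survive, since [0 ^+ 0 = 1]. *)
Lemma meval_limit p w v c :
  (forall t, t != 0 -> p.@[fun i => t ^+ w i * v i] = c) ->
  p.@[fun i => 0 ^+ w i * v i] = c.
Proof.
move=> pc; suff /(congr1 (horner^~ 0)) : scale_poly p w v - c%:P = 0.
  by rewrite hornerD hornerN hornerC horner_scale_poly horner0 => /subr0_eq.
by apply: poly_eq0_off0 => t t0; rewrite hornerD hornerN hornerC
  horner_scale_poly pc ?subrr.
Qed.

(** The variables are treated one at a time: by [part], the terms of [p] whose exponents agree with
    [mu] on [s] sum to zero at every point. When [s] lists all indices, only the term of [mu] is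
    left. *)
Lemma meval_eq0 p : (forall v, p.@[v] = 0) -> p = 0.
Proof.
move=> p0; apply/mpolyP => mu; rewrite mcoeff0.
have part (s : seq 'I_n) v : \sum_(m <- msupp p | all (fun i => m i == mu i) s)
    p@_m * \prod_i v i ^+ m i = 0.
  elim: s v => [|i s ih] v; first by rewrite -mevalE.
  pose q : {poly K} := \sum_(m <- msupp p | all (fun i => m i == mu i) s)
    (p@_m * \prod_i v i ^+ m i) *: 'X^(m i).
  have q0 : q = 0.
    apply: poly_eq0_off0 => t _.
    rewrite -(ih (fun j => t ^+ (j == i) * v j)) horner_sum.
    apply: eq_bigr => m _; rewrite hornerZ hornerXn -mulrA; congr (_ * _).
    under [RHS]eq_bigr => j _ do rewrite exprMn -exprM.
    rewrite big_split /= mulrC; congr (_ * _).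
    rewrite (bigD1 i) //= eqxx mul1n big1 ?mulr1 // => j /negbTE ->.
    by rewrite mul0n.
  have /(congr1 (fun r : {poly K} => r`_(mu i))) := q0.
  rewrite coef_sum coef0 => q0i; rewrite -[RHS]q0i.
  rewrite big_mkcond [RHS]big_mkcond /=.
  apply: eq_bigr => m _; rewrite coefZ coefXn eq_sym.
  by case: all; rewrite ?andbF ?andbT //; case: eqP; rewrite ?mulr0 ?mulr1.
have := part (enum 'I_n) (fun=> 1).
have [mup|] := boolP (mu \in msupp p); last by move/memN_msupp_eq0.
rewrite -big_filter (bigD1_seq mu) /=; first last.
- by rewrite filter_uniq.
- by rewrite mem_filter mup andbT; apply/allP.
rewrite [X in p@_mu * X]big1 ?mulr1; last by move=> i _; rewrite expr1n.
rewrite big_filter_cond big1 ?addr0 // => m /andP [/allP mmu].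
by rewrite (_ : m = mu) ?eqxx //; apply/mnmP=> i; apply/eqP/mmu; rewrite mem_enum.
Qed.

Lemma meval_inj p q : (forall v, p.@[v] = q.@[v]) -> p = q.
Proof.
by move=> pq; apply/subr0_eq/meval_eq0=> v; rewrite mevalB pq subrr.
Qed.

(** Along every curve, [scale_poly p w v] is a multiple of ['X^e]. So a component [q] of another
    weight vanishes at all points and is zero, against its coefficient at [mu]. *)
Lemma weight_msupp p w e :
    (forall t v, t != 0 -> p.@[fun i => t ^+ w i * v i] = t ^+ e * p.@[v]) ->
  {in msupp p, forall m, weight w m = e}.
Proof.
move=> pe mu mup; apply/eqP; apply: contraT => mue.
pose q : {mpoly K[n]} :=
  \sum_(m <- msupp p | weight w m == weight w mu) p@_m *: 'X_[m].
have q0 : q = 0.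
  apply: meval_eq0 => v; rewrite raddf_sum /=.
  under eq_bigr => m _ do rewrite mevalZ mevalX.
  rewrite -coef_scale_poly; have -> : scale_poly p w v = p.@[v] *: 'X^e.
    apply/subr0_eq/poly_eq0_off0 => t t0.
    by rewrite hornerD hornerN horner_scale_poly hornerZ hornerXn pe // mulrC subrr.
  by rewrite coefZ coefXn (negbTE mue) mulr0.
have : q@_mu = p@_mu.
  rewrite raddf_sum /= -big_filter (bigD1_seq mu) /=; first last.
  - by rewrite filter_uniq.
  - by rewrite mem_filter eqxx.
  rewrite mcoeffZ mcoeffX eqxx mulr1 big1 ?addr0 // => m /negbTE mmu.
  by rewrite mcoeffZ mcoeffX mmu mulr0.
by rewrite q0 mcoeff0 => /esym /eqP; rewrite mcoeff_eq0 mup.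
Qed.

End Evaluation.

Lemma meval_dhomog (R : comRingType) n d (p : {mpoly R[n]}) t v :
  p \is d.-homog -> p.@[fun i => t * v i] = t ^+ d * p.@[v].
Proof.
move=> /dhomogP hp; rewrite !mevalE mulr_sumr big_seq [RHS]big_seq.
apply: eq_bigr => m mp; rewrite mulrCA; congr (_ * _).
under eq_bigr => i _ do rewrite exprMn.
by rewrite big_split -expr_sum -[in RHS](hp m mp) /= mdegE.
Qed.

(** * Words up to permutation, and monomials *)

Section Content.
Variables (N d : nat).
Implicit Types (b : {ffun 'I_d -> 'I_N}).

(** The exponents of the monomial that a word becomes when its letters commute; it classifies the
    orbits of words under permutation. *)
Definition content b : 'X_{1..N} := (\sum_k U_(b k))%MM.

Lemma mdeg_content b : mdeg (content b) = d.
Proof.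
rewrite mdeg_sum; under eq_bigr => k _ do rewrite mdeg1.
by rewrite sum1_card card_ord.
Qed.

Lemma meval_content (R : comRingType) b (v : 'I_N -> R) :
  'X_[content b].@[v] = \prod_k v (b k).
Proof.
rewrite (big_morph _ (@mpolyXD N R) (@mpolyX0 N R)) rmorph_prod.
by apply: eq_bigr => k _; exact: mevalXU.
Qed.

Lemma content_perm b (s : 'S_d) : content [ffun k => b (s k)] = content b.
Proof.
rewrite /content [RHS](reindex_inj (@perm_inj _ s)) /=.
by apply: eq_bigr => k _; rewrite ffunE.
Qed.

Lemma contentE b i : content b i = count_mem i [tuple b k | k < d].
Proof.
rewrite mnm_sumE -sum1_count big_map [RHS]big_mkcond /= big_enum /=.
by apply: eq_bigr => k _; rewrite mnm1E; case: eqP.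
Qed.

Lemma content_eq_perm b b' :
  content b = content b' -> exists s : 'S_d, b' = [ffun k => b (s k)].
Proof.
move=> bb'; have : perm_eq [tuple b' k | k < d] [tuple b k | k < d].
  by apply/allP => i _; rewrite /= -!contentE bb' eqxx.
case/tuple_permP => s /val_inj bs; exists s; apply/ffunP => k.
by have /(congr1 (fun t : d.-tuple _ => tnth t k)) := bs; rewrite !tnth_mktuple ffunE.
Qed.

Lemma content_surj m : mdeg m = d -> exists b, content b = m.
Proof.
move=> md; pose s := flatten [seq nseq (m i) i | i <- enum 'I_N].
have sE (f : 'I_N -> 'X_{1..N}) :
    (\big[mnm_add/0%MM]_(i <- s) f i = \sum_i (f i *+ m i))%MM.
  rewrite big_flatten big_map big_enum; apply: eq_bigr => i _.
  rewrite big_nseq; elim: (m i) => [|k ih] /=; first by rewrite mulm0n.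
  by rewrite ih mulmS.
have sz : size s == d.
  rewrite size_flatten /shape -map_comp sumnE big_map big_enum -md mdegE.
  by apply/eqP/eq_bigr => i _; rewrite /= size_nseq.
exists [ffun k => tnth (Tuple sz) k].
rewrite /content; under eq_bigr => k _ do rewrite ffunE.
rewrite -(big_tuple _ _ (Tuple sz) xpredT (fun i => U_(i)%MM)) /= sE.
by rewrite -multinomUE_id.
Qed.
End Content.

(** * Separation of a vector from a span by a functional *)

(** The span is only a predicate, so a subspace [U] of largest dimension inside it is taken;
    maximality forces [X] into [U]. The map [g], identity minus projection to [U], vanishes exactly
    on [U], and one of its coordinates is the functional. *)
Lemma lspan_separation (R : fieldType) (A : finType) (X : {ffun A -> R^o} -> Prop) v :
  v \notin lspan X -> exists c : A -> R,
    (forall x, X x -> \sum_a c a * x a = 0) /\ \sum_a c a * v a != 0.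
Proof.
move=> vX; pose V := {ffun A -> R^o}.
pose P k := `[< exists U : {vspace V}, {subset U <= lspan X} /\ \dim U = k >].
have P0 : exists k, P k.
  exists 0%N; apply/asboolP; exists 0%VS; rewrite dimv0; split=> // u.
  by rewrite memv0 => /eqP ->; apply: rpred0.
have Pub k : P k -> (k <= \dim {:V})%N.
  by move=> /asboolP [U [_ <-]]; rewrite dimvS ?subvf.
case: (ex_maxnP P0 Pub) => k /asboolP [U [UX dU]] kmax.
have XU x : X x -> x \in U.
  move=> Xx; apply: contraT => xU.
  have : P (\dim (U + <[x]>)).
    apply/asboolP; exists (U + <[x]>)%VS; split=> // ?.
    move=> /memv_addP [u uU [_ /vlineP [c ->] ->]].
    apply: rpredD; first exact: UX.
    by apply: rpredZ; apply/asboolP; rewrite -[x]scale1r -[_ *: x]addr0;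
      apply: lspanD Xx _; apply: lspan0.
  move=> /kmax; rewrite -dU leqNgt => /negP []; rewrite ltn_neqAle dimvS ?addvSl // andbT.
  apply/negP => /eqP UE; case/negP: xU.
  have /eqP -> : U == (U + <[x]>)%VS by rewrite eqEdim addvSl -UE /=.
  by rewrite memvE addvSr.
have vU : v \notin U by apply: contra vX => /UX.
pose g (u : V) : V := u - projv U u.
have gl : linear g.
  by move=> c u u'; rewrite /g linearP opprD addrACA -scalerBr.
have [a ga] : exists a, g v a != 0.
  apply/existsP; apply: contraR vU; rewrite negb_exists => /forallP gv.
  have /subr0_eq -> : g v = 0.
    by apply/ffunP => a; rewrite [RHS]ffunE; apply/eqP; rewrite -[_ == _]negbK gv.
  exact: memv_proj.
pose dl b : V := [ffun b' => (b' == b)%:R].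
have gE u : g u a = \sum_b g (dl b) a * u b.
  have {1}-> : u = \sum_b u b *: dl b.
    apply/ffunP => b; rewrite sum_ffunE (bigD1 b) //= !ffunE eqxx [_ *: _]mulr1.
    by rewrite big1 ?addr0 // => b' /negbTE bb'; rewrite !ffunE eq_sym bb' [_ *: _]mulr0.
  pose G := GRing.isLinear.Build R V V _ g gl.
  pose gL : {linear V -> V} := HB.pack g G.
  rewrite -[g]/(gL : V -> V) linear_sum sum_ffunE; apply: eq_bigr => b _.
  by rewrite linearZ ffunE mulrC.
exists (fun b => g (dl b) a); rewrite -gE; split=> // x /XU xU.
by rewrite -gE /g projv_id // subrr ffunE.
Qed.

Lemma divpow_lspan_separation (R : fieldType) (I : finType) (d : nat)
    (X : divpow I d R -> Prop) w :
  w \notin lspan X -> exists c : {ffun 'I_d -> I} -> R,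
    (forall x, X x -> \sum_a c a * val x a = 0) /\ \sum_a c a * val w a != 0.
Proof.
move=> wX; pose X' (t : tens I d R) := exists x, X x /\ t = val x.
have [|c [cX cw]] := @lspan_separation R _ X' (val w); last first.
  by exists c; split=> // x Xx; apply: cX; exists x.
apply: contra wX => /asboolP sw; apply/asboolP.
have [x []] : exists x, lspan_prop X x /\ val w = val x.
  elim: sw => [|a _ _ [x [Xx ->]] _ [y [Xy ->]]].
    by exists 0; split; [exact: lspan0|].
  by exists (a *: x + y); split=> //; apply: lspanD.
by move=> Xx /val_inj ->.
Qed.

(** * The pairing of polynomials with symmetric tensors *)

Section Pairing.
Variables (N d : nat) (R : fieldType).
Implicit Types (b : {ffun 'I_d -> 'I_N}) (f : {mpoly R[N]}) (T : tens 'I_N d R).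

Lemma symtens_content T b b' :
  T \in symtens 'I_N d R -> content b = content b' -> T b = T b'.
Proof.
by move=> /symtensP sT /content_eq_perm [s ->]; rewrite -{1}(sT s) ffunE.
Qed.

Lemma monom_word_subproof (mu : monom N d) :
  exists b : {ffun 'I_d -> 'I_N}, content b == val mu.
Proof.
by have [b <-] := content_surj (eqP (valP mu)); exists b.
Qed.

(** An arbitrary choice: a symmetric tensor takes the same value at all words with content [mu]. *)
Definition monom_word mu := xchoose (monom_word_subproof mu).

Lemma content_monom_word mu : content (monom_word mu) = val mu.
Proof. exact/eqP/(xchooseP (monom_word_subproof mu)). Qed.

Lemma content_bounded b : (mdeg (content b) < d.+1)%N.
Proof. by rewrite mdeg_content. Qed.

Lemma content_monom_subproof b : mdeg (BMultinom (content_bounded b)) == d.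
Proof. exact/eqP/mdeg_content. Qed.

Definition content_monom b : monom N d :=
  exist _ (BMultinom (content_bounded b)) (content_monom_subproof b).

Lemma content_monomE b mu : (content_monom b == mu) = (content b == val mu).
Proof. by rewrite -!val_eqE. Qed.

Lemma monom_wordK : cancel monom_word content_monom.
Proof. by move=> mu; apply/eqP; rewrite content_monomE content_monom_word. Qed.

(* The perfect pairing between [Sym^d] of the dual space and [Sym_d]. *)
Definition pairing f T := \sum_(mu : monom N d) f@_(val mu) * T (monom_word mu).

Lemma pairing_linear f : linear (pairing f : _ -> R^o).
Proof.
move=> c T U; rewrite /pairing scaler_sumr -big_split /=.
by apply: eq_bigr => mu _; rewrite !ffunE mulrDr scalerAr.
Qed.
Lemma pairing_suml (J : finType) (c : J -> R) (F : J -> {mpoly R[N]}) T :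
  pairing (\sum_j c j *: F j) T = \sum_j c j * pairing (F j) T.
Proof.
rewrite /pairing; under [RHS]eq_bigr => j _ do rewrite mulr_sumr.
rewrite exchange_big; apply: eq_bigr => mu _ /=.
rewrite raddf_sum mulr_suml; apply: eq_bigr => j _.
by rewrite /= mcoeffZ mulrA.
Qed.

(** The pure power $v^{\otimes d}$; pairing with it is evaluation at [v]. *)
Definition tpow (v : 'I_N -> R) : tens 'I_N d R :=
  [ffun b : {ffun 'I_d -> 'I_N} => \prod_k v (b k)].

Lemma tpow_sym v : tpow v \in symtens 'I_N d R.
Proof.
apply/symtensP => s; apply/ffunP => b; rewrite !ffunE.
rewrite [RHS](reindex_inj (@perm_inj _ s)) /=.
by apply: eq_bigr => k _; rewrite ffunE.
Qed.

Definition dpow v : divpow 'I_N d R := Subm (tpow_sym v).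

Lemma pairing_tpow f v : f \is d.-homog -> pairing f (tpow v) = f.@[v].
Proof.
move=> /homog_monomE fE; rewrite [in RHS]fE raddf_sum; apply: eq_bigr => mu _ /=.
by rewrite mevalZ ffunE -meval_content content_monom_word.
Qed.

Lemma tens_map_tpow (A : 'I_N -> 'I_N -> R) v :
  tens_map A (tpow v) = tpow (fun i => \sum_j A i j * v j).
Proof.
apply/ffunP => a; rewrite !ffunE bigA_distr_bigA /=; apply: eq_bigr => b _.
by rewrite ffunE big_split.
Qed.

(** On symmetric tensors, the functional with coefficients [c] is the pairing with this
    polynomial. *)
Definition functional_poly (c : {ffun 'I_d -> 'I_N} -> R) : {mpoly R[N]} :=
  \sum_b c b *: 'X_[content b].

Lemma functional_poly_homog c : functional_poly c \is d.-homog.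
Proof.
by apply: rpred_sum => b _; apply: dhomogZ; rewrite dhomogX /= mdeg_content.
Qed.

Lemma pairing_functional_poly c T : T \in symtens 'I_N d R ->
  pairing (functional_poly c) T = \sum_b c b * T b.
Proof.
move=> sT; rewrite pairing_suml; apply: eq_bigr => b _; congr (_ * _).
rewrite /pairing (bigD1 (content_monom b)) //= mcoeffX eqxx mul1r.
rewrite big1 ?addr0 => [|mu].
  by apply: symtens_content => //; rewrite content_monom_word.
by rewrite eq_sym content_monomE mcoeffX => /negbTE ->; rewrite mul0r.
Qed.
End Pairing.

(** A functional that kills all pure powers is the pairing with a polynomial vanishing at every
    point, hence is zero on symmetric tensors. *)
Lemma divpow_dpow_span (K : closedFieldType) N d (T : divpow 'I_N d K) :
  T \in lspan (fun U => exists v, U = dpow d v).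
Proof.
apply: contraT => /divpow_lspan_separation [c [c0]].
rewrite -pairing_functional_poly ?(valP T) //.
suff -> : functional_poly c = 0.
  by rewrite /pairing big1 ?eqxx // => mu _; rewrite mcoeff0 mul0r.
apply: meval_eq0 => v; rewrite -(pairing_tpow _ (functional_poly_homog c)).
by rewrite pairing_functional_poly ?tpow_sym // (c0 (dpow d v)) //; exists v.
Qed.

(** * Points of the tensor space as pairs of matrices *)

Section Points.
Variables (R : fieldType) (n : nat).
Implicit Types (X : 'I_2 -> 'M[R]_n) (z : 'M[R]_n) (g : 'M[R]_2).

Definition idx (i j : 'I_n) (k : 'I_2) : 'I_(n * n * 2) :=
  mxtens_index (mxtens_index (i, j), k).
Definition idx_row (t : 'I_(n * n * 2)) : 'I_n :=
  (mxtens_unindex (mxtens_unindex t).1).1.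
Definition idx_col (t : 'I_(n * n * 2)) : 'I_n :=
  (mxtens_unindex (mxtens_unindex t).1).2.
Definition idx_slice (t : 'I_(n * n * 2)) : 'I_2 := (mxtens_unindex t).2.

Lemma idx_rowE i j k : idx_row (idx i j k) = i.
Proof. by rewrite /idx_row !mxtens_indexK. Qed.
Lemma idx_colE i j k : idx_col (idx i j k) = j.
Proof. by rewrite /idx_col !mxtens_indexK. Qed.
Lemma idx_sliceE i j k : idx_slice (idx i j k) = k.
Proof. by rewrite /idx_slice !mxtens_indexK. Qed.
Definition idxE := (idx_rowE, idx_colE, idx_sliceE).

Lemma idxK t : idx (idx_row t) (idx_col t) (idx_slice t) = t.
Proof.
rewrite /idx /idx_row /idx_col /idx_slice -surjective_pairing mxtens_unindexK.
by rewrite -surjective_pairing mxtens_unindexK.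
Qed.

Variant is_idx : 'I_(n * n * 2) -> Type := IsIdx i j k : is_idx (idx i j k).
Lemma idxP t : is_idx t. Proof. by rewrite -[t]idxK. Qed.

Lemma big_idx (S : Type) (x0 : S) (op : Monoid.com_law x0) (G : 'I_(n * n * 2) -> S) :
  \big[op/x0]_t G t =
  \big[op/x0]_i \big[op/x0]_j \big[op/x0]_k G (idx i j k).
Proof.
under [RHS]eq_bigr => i _ do rewrite pair_bigA.
rewrite pair_bigA /= (reindex (fun p : 'I_n * ('I_n * 'I_2) => idx p.1 p.2.1 p.2.2)) //.
exists (fun t => (idx_row t, (idx_col t, idx_slice t))) => [[i [j k]] _|t _].
  by rewrite /= !idxE.
exact: idxK.
Qed.

Definition pt X (t : 'I_(n * n * 2)) : R := X (idx_slice t) (idx_row t) (idx_col t).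

Lemma ptE X i j k : pt X (idx i j k) = X k i j.
Proof. by rewrite /pt !idxE. Qed.

Definition slices (v : 'I_(n * n * 2) -> R) k : 'M[R]_n := \matrix_(i, j) v (idx i j k).

Lemma pt_slices v : pt (slices v) =1 v.
Proof. by move=> t; rewrite /pt mxE idxK. Qed.

Definition pencil_act z1 z2 g X k : 'M[R]_n :=
  \sum_k' g k k' *: (z1 *m X k' *m z2^T).

Lemma kron3_pt z1 z2 g X t :
  \sum_t' kron3 z1 z2 g t t' * pt X t' = pt (pencil_act z1 z2 g X) t.
Proof.
case: (idxP t) => i j k; rewrite big_idx ptE summxE.
under eq_bigr => i' _ do (under eq_bigr => j' _ do
  under eq_bigr => k' _ do rewrite ptE /kron3 !tensmxE).
under eq_bigr => i' _ do rewrite exchange_big /=.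
rewrite exchange_big; apply: eq_bigr => k' _ /=.
rewrite !mxE mulr_sumr exchange_big; apply: eq_bigr => j' _ /=.
rewrite !mxE !mulr_suml mulr_sumr; apply: eq_bigr => i' _.
by rewrite !mulrA [g k k' * _]mulrC -!mulrA; congr (_ * _); rewrite mulrC -!mulrA mulrCA.
Qed.

Lemma pencil_act1 z1 z2 X k : pencil_act z1 z2 1%:M X k = z1 *m X k *m z2^T.
Proof.
rewrite /pencil_act (bigD1 k) //= mxE eqxx scale1r big1 ?addr0 // => k' /negbTE kk'.
by rewrite mxE eq_sym kk' scale0r.
Qed.
End Points.

Lemma meval_mpoly_map (R : fieldType) N (A : 'M[R]_N) p v :
  (mpoly_map A p).@[v] = p.@[fun j => \sum_i A i j * v i].
Proof.
rewrite /mpoly_map comp_mpoly_meval; apply: meval_eq => j.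
rewrite tnth_mktuple raddf_sum; apply: eq_bigr => i _ /=.
by rewrite mevalZ mevalXU.
Qed.

Lemma trmx_kron3 (R : fieldType) n (z1 z2 : 'M[R]_n) g :
  (kron3 z1 z2 g)^T = kron3 z1^T z2^T g^T.
Proof. by apply/matrixP=> s t; rewrite !mxE. Qed.

(** Transposes appear because [mpoly_map] acts on the variables as basis vectors, and so by the
    transposed matrix on points. *)
Lemma meval_kron3 (R : fieldType) n (z1 z2 : 'M[R]_n) g p X :
  (mpoly_map (kron3 z1 z2 g) p).@[pt X] = p.@[pt (pencil_act z1^T z2^T g^T X)].
Proof.
rewrite meval_mpoly_map; apply: meval_eq => t; rewrite -kron3_pt -trmx_kron3.
by apply: eq_bigr => s _; rewrite [(_^T) t s]mxE.
Qed.

(** * Invariants of pairs of matrices, and reduction to diagonal pairs *)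

(** Induction on the size: in a basis starting with a row eigenvector, the first row of the matrix
    is zero off the diagonal, and the lower right block is handled by induction. *)
Lemma trigonalization (K : closedFieldType) n (A : 'M[K]_n) :
  exists2 P, P \in unitmx & exists2 T, is_trig_mx T & P *m A = T *m P.
Proof.
elim: n A => [|n IHn] A.
  exists 1%:M; first exact: unitmx1.
  by exists A; [apply/is_trig_mxP => -[] | rewrite mulmx1 mul1mx].
rewrite -[n.+1]/(1 + n)%N in A *.
have /closed_rootP [a] : size (char_poly A) != 1 by rewrite size_char_poly.
rewrite -eigenvalue_root_char => /eigenvalueP [v vA v0].
pose P0 := row_ebase v; have P0u : P0 \in unitmx := row_ebase_unit v.
have rv : \rank v = 1%N by rewrite rank_rV v0.
pose e : 'rV[K]_(1 + n) := pid_mx 1.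
(* The eigenvector is a multiple of the first row of [P0], so after conjugation by [P0] it becomes a
   multiple of [e]. *)
have [c c0 vE] : exists2 c, c != 0 & v = c *: (e *m P0).
  exists (col_ebase v 0 0).
    have := col_ebase_unit v; rewrite unitmxE det_mx11 unitfE; exact.
  by rewrite -[LHS]mulmx_ebase rv {1}[col_ebase v]mx11_scalar mul_scalar_mx scalemxAl.
have eB : e *m (P0 *m A *m invmx P0) = a *: e.
  apply: (scalerI c0); rewrite !mulmxA 2!scalemxAl -vE vA vE.
  by rewrite -!scalemxAl mulmxK // scalerA scalerA mulrC.
set B := P0 *m A *m invmx P0 in eB; rewrite -[B]submxK in eB.
have eE : e = row_mx 1%:M 0.
  by rewrite -[e]hsubmxK; congr row_mx; apply/matrixP=> i j; rewrite !mxE !ord1.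
move: eB; rewrite eE.
rewrite mul_row_block !mul1mx !mul0mx !addr0 scale_row_mx scaler0 => /eq_row_mx [_ ur].
have [Q Qu [T Ttrig QT]] := IHn (drsubmx B).
pose Q1 : 'M[K]_(1 + n) := block_mx 1%:M 0 0 Q.
have Q1u : Q1 \in unitmx by rewrite unitmxE det_lblock det1 mul1r -unitmxE.
exists (Q1 *m P0); first by rewrite unitmx_mul Q1u.
exists (block_mx (ulsubmx B) 0 (Q *m dlsubmx B) T).
  by rewrite is_trig_block_mx // eqxx mx11_is_trig.
have BP : P0 *m A = B *m P0 by rewrite /B mulmxKV.
clearbody B; rewrite -mulmxA BP !mulmxA; congr (_ *m _); rewrite -[B in LHS]submxK ur.
by rewrite !mulmx_block !mulmx0 !mul0mx !mul1mx !mulmx1 !addr0 !add0r QT.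
Qed.

(** Invariance in terms of values; writing [z2] instead of its transpose only reparametrises
    [SL_n]. *)
Definition sl_invariant (K : fieldType) n (f : {mpoly K[n * n * 2]}) :=
  forall z1 z2 X, \det z1 = 1 -> \det z2 = 1 ->
    f.@[pt (fun k => z1 *m X k *m z2)] = f.@[pt X].

Section SemiInvariants.
Variables (K : closedFieldType) (n k : nat).
Hypothesis n_gt0 : (0 < n)%N.
Variable f : {mpoly K[n * n * 2]}.
Hypothesis f_homog : f \is (n * k).-homog.
Hypothesis f_inv : sl_invariant f.

Lemma exists_root (c : K) : c != 0 -> exists2 a, a != 0 & a ^+ n = c.
Proof.
move=> c0; have /closed_rootP [a] : size ('X^n - c%:P) != 1.
  by rewrite size_XnsubC // eqSS -lt0n.
rewrite rootE !hornerE subr_eq0 => /eqP an; exists a => //.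
by apply: contraNneq c0 => a0; rewrite -an a0 expr0n gtn_eqF.
Qed.

(** Division by [n]-th roots of the determinants moves [z1] and [z2] into [SL_n]; the scalar comes
    out by homogeneity of degree [n * k]. *)
Lemma semi_invariance z1 z2 X : \det z1 != 0 -> \det z2 != 0 ->
  f.@[pt (fun k => z1 *m X k *m z2)] = (\det z1 * \det z2) ^+ k * f.@[pt X].
Proof.
move=> d1 d2; have [a a0 aE] := exists_root d1; have [b b0 bE] := exists_root d2.
rewrite -(@f_inv (a^-1 *: z1) (b^-1 *: z2) X); first last.
- by rewrite detZ exprVn bE mulVf.
- by rewrite detZ exprVn aE mulVf.
rewrite -aE -bE -exprMn -exprM -(meval_dhomog _ _ f_homog).
apply: meval_eq => t; rewrite /pt -!scalemxAl -scalemxAr scalerA.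
rewrite [X in _ = _ * X]mxE -invfM.
by rewrite mulVKf ?mulf_neq0.
Qed.

(** Conjugation by [D t] multiplies the entry at [(i, j)] by [t] to the power [i - j] and preserves
    [f]; the limit at [t = 0] of a lower triangular pair is its diagonal. *)
Lemma meval_trig X : (forall k, is_trig_mx (X k)) ->
  f.@[pt X] = f.@[pt (fun k => diag_mx (\row_i X k i i))].
Proof.
(* Above the diagonal the truncated subtraction gives weight 0, but there the entries are zero. *)
move=> Xtrig; pose w t := (@idx_row n t - idx_col t)%N.
rewrite -(@meval_limit _ _ f w (pt X) f.@[pt X]).
  apply: meval_eq => t; rewrite /pt /w !mxE -val_eqE.
  case: (ltngtP (idx_row t) (idx_col t)) => [ij|ij|/val_inj <-].
  - by rewrite (is_trig_mxP (Xtrig _) _ _ ij) mulr0.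
  - by rewrite expr0n subn_eq0 leqNgt ij mul0r.
  - by rewrite subnn mul1r.
move=> t t0; pose D (u : K) : 'M[K]_n := diag_mx (\row_i u ^+ i).
have dD u : u != 0 -> \det (D u) != 0.
  move=> u0; rewrite det_diag; apply/prodf_neq0 => i _.
  by rewrite mxE expf_neq0.
transitivity (f.@[pt (fun k => D t *m X k *m D t^-1)]).
  apply: meval_eq => s; rewrite /pt /w mul_diag_mx mul_mx_diag !mxE.
  case: (leqP (idx_col s) (idx_row s)) => ij.
    rewrite -{2}(subnK ij) exprD -!mulrA; congr (_ * _).
    by rewrite mulrCA exprVn mulfV ?mulr1 // expf_neq0.
  by rewrite (is_trig_mxP (Xtrig _) _ _ ij) !(mulr0, mul0r).
rewrite semi_invariance ?dD ?invr_eq0 //.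
rewrite -det_mulmx (_ : _ *m _ = 1%:M) ?det1 ?expr1n ?mul1r //.
apply/matrixP=> i j; rewrite mul_diag_mx !mxE exprVn.
by case: eqP => [->|_]; rewrite ?mulr0 // mulfV ?expf_neq0.
Qed.

(** Multiplying [f] by the determinant of the generic first matrix leaves only pairs with [X 0]
    invertible. Then [P *m invmx (X 0)] on the left and [invmx P] on the right turn the pair into
    the identity and the triangular [T]. *)
Lemma diag_vanishing :
  (forall x : 'I_2 -> 'rV[K]_n, f.@[pt (fun k => diag_mx (x k))] = 0) -> f = 0.
Proof.
move=> f0; pose M : 'M[{mpoly K[n * n * 2]}]_n := \matrix_(i, j) 'X_(idx i j 0).
have detM X : (\det M).@[pt X] = \det (X 0).
  rewrite -det_map_mx; congr (\det _); apply/matrixP=> i j.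
  by rewrite !mxE /= mevalXU ptE.
have M0 : \det M != 0.
  apply: contra_neq (oner_neq0 K) => M0.
  by rewrite -(det1 K n) -(detM (fun=> 1%:M)) M0 meval0.
suff : f * \det M = 0 by move/eqP; rewrite mulf_eq0 (negbTE M0) orbF => /eqP.
apply: meval_eq0 => v; rewrite -(meval_eq _ (pt_slices v)) mevalM detM.
move: (slices v) => X; have [->|X0] := eqVneq (\det (X 0)) 0; first by rewrite mulr0.
have X0u : X 0 \in unitmx by rewrite unitmxE unitfE.
have [P Pu [T Ttrig PT]] := trigonalization (invmx (X 0) *m X 1).
have d1 : \det (P *m invmx (X 0)) != 0.
  by rewrite -unitfE -unitmxE unitmx_mul Pu unitmx_inv.
have d2 : \det (invmx P) != 0 by rewrite -unitfE -unitmxE unitmx_inv.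
have := semi_invariance X d1 d2; rewrite meval_trig; last first.
  move=> i; have [->|->] : i = 0 \/ i = 1.
    by case: i => -[|[|//]] ?; [left|right]; apply/val_inj.
    by rewrite mulmxKV // mulmxV.
  by rewrite -(mulmxA P) PT mulmxK.
rewrite f0 => /esym/eqP; rewrite mulf_eq0 expf_eq0 mulf_eq0 (negbTE d1) (negbTE d2).
by rewrite andbF => /eqP ->; rewrite mul0r.
Qed.

(** Scaling row [i] of both matrices by [t] is a left multiplication of determinant [t], so it
    multiplies [f] by [t ^+ k]. *)
Lemma row_degree m i : m \in msupp f ->
  (\sum_j \sum_k m (idx i j k) = k)%N.
Proof.
move=> mf; pose w t := (@idx_row n t == i : nat).
rewrite -(@weight_msupp _ _ f w k _ m mf) => [|t v t0].
  rewrite /weight big_idx [RHS](bigD1 i) //= [X in (_ + X)%N]big1 ?addn0.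
    by apply: eq_bigr => j _; apply: eq_bigr => s _; rewrite /w idx_rowE eqxx mul1n.
  by move=> r /negbTE ri; rewrite big1 // => j _; rewrite big1 // => s _;
    rewrite /w idx_rowE ri.
pose D : 'M[K]_n := diag_mx (\row_j t ^+ (j == i)).
have dD : \det D = t.
  rewrite det_diag (bigD1 i) //= mxE eqxx expr1 big1 ?mulr1 // => j /negbTE ji.
  by rewrite mxE ji.
transitivity f.@[pt (fun s => D *m slices v s *m 1%:M)].
  by apply: meval_eq => s; rewrite /pt mulmx1 mul_diag_mx !mxE idxK.
rewrite semi_invariance ?dD ?det1 ?oner_neq0 // mulr1.
by rewrite (meval_eq _ (pt_slices v)).
Qed.
End SemiInvariants.

(** * Tensors over [Sym^q] as multihomogeneous polynomials *)

Section WordEval.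
Variables (R : fieldType) (p q : nat).
Implicit Types (T : tens (monom 2 q) p R) (x : 'I_p -> 'I_2 -> R).

(* [T] read as a polynomial in [p] pairs of variables, homogeneous of degree [q]
   in each pair. *)
Definition word_eval T x : R := \sum_a T a * \prod_i 'X_[val (a i)].@[x i].

Lemma word_evalB T U x : word_eval (T - U) x = word_eval T x - word_eval U x.
Proof.
rewrite /word_eval -sumrB; apply: eq_bigr => a _.
by rewrite !ffunE mulrBl.
Qed.

Lemma word_eval_perm s T x :
  word_eval (tens_perm s T) x = word_eval T (fun i => x (s i)).
Proof.
pose h (t : 'S_p) (a : {ffun 'I_p -> monom 2 q}) := [ffun i => a (t i)].
have hK t : cancel (h t) (h t^-1%g) by move=> a; apply/ffunP=> i; rewrite !ffunE permKV.
rewrite /word_eval (reindex (h s^-1%g)); last first.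
  by exists (h s) => a _; [rewrite -{1}[s]invgK hK | rewrite hK].
apply: eq_bigr => a _; rewrite ffunE; congr (_ * _).
  by congr (T _); apply/ffunP=> i; rewrite !ffunE permK.
rewrite (reindex_inj (@perm_inj _ s)); apply: eq_bigr => i _ /=.
by rewrite ffunE permK.
Qed.

Lemma meval_sympow_mx (g : 'M[R]_2) (b : monom 2 q) (v : 'I_2 -> R) :
  \sum_a sympow_mx g a b * 'X_[val a].@[v] =
  'X_[val b].@[fun k' => \sum_k g k k' * v k].
Proof.
rewrite -meval_mpoly_map (@homog_monomE 2 q _ (mpoly_map g _)); last first.
  by apply: mpoly_map_homog; rewrite dhomogX; exact: valP b.
by rewrite raddf_sum; apply: eq_bigr => a _; rewrite /= mevalZ.
Qed.

Lemma word_eval_map g T x :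
  word_eval (tens_map (@sympow_mx 2 q R g) T) x =
  word_eval T (fun i k' => \sum_k g k k' * x i k).
Proof.
rewrite /word_eval; under eq_bigr => a _ do rewrite ffunE mulr_suml.
rewrite exchange_big; apply: eq_bigr => b _ /=.
under [in RHS]eq_bigr => i _ do rewrite -meval_sympow_mx.
rewrite bigA_distr_bigA mulr_sumr; apply: eq_bigr => a _.
by rewrite big_split /= mulrCA !mulrA.
Qed.

(** The letter [a i] gives the exponents of the two diagonal entries at position [i]. *)
Definition diag_monom (a : {ffun 'I_p -> monom 2 q}) : 'X_{1..p * p * 2} :=
  [multinom if idx_row t == idx_col t then val (a (idx_row t)) (idx_slice t) else 0%N
    | t < p * p * 2].

Lemma meval_diag_monom a (X : 'I_2 -> 'M[R]_p) :
  'X_[diag_monom a].@[pt X] = \prod_i 'X_[val (a i)].@[fun k => X k i i].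
Proof.
rewrite mevalX big_idx; apply: eq_bigr => i _; rewrite mevalX.
rewrite (bigD1 i) //= [X in _ * X]big1 ?mulr1.
  by apply: eq_bigr => k _; rewrite mnmE !idxE eqxx ptE.
move=> j /negbTE ij; rewrite big1 // => k _.
by rewrite mnmE !idxE eq_sym ij.
Qed.

Lemma diag_monom_inj : injective diag_monom.
Proof.
move=> a b ab; apply/ffunP=> i; apply/val_inj/val_inj/mnmP=> k.
have /(congr1 (fun m : 'X_{1..p * p * 2} => m (idx i i k))) := ab.
by rewrite !mnmE !idxE eqxx.
Qed.

(* The restriction of [f] to pairs of diagonal matrices. *)
Definition diag_part (f : {mpoly R[p * p * 2]}) : tens (monom 2 q) p R :=
  [ffun a => f@_(diag_monom a)].

Lemma diag_part_linear : linear diag_part.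
Proof. by move=> c f g; apply/ffunP=> a; rewrite !ffunE mcoeffD mcoeffZ. Qed.
HB.instance Definition _ :=
  GRing.isLinear.Build R {mpoly R[p * p * 2]} (tens (monom 2 q) p R) _ diag_part
    diag_part_linear.
End WordEval.

Lemma word_eval_eq0 (K : closedFieldType) p q (T : tens (monom 2 q) p K) :
  (forall x, word_eval T x = 0) -> T = 0.
Proof.
move=> T0; pose P : {mpoly K[p * p * 2]} := \sum_a T a *: 'X_[diag_monom a].
have P0 : P = 0.
  apply: meval_eq0 => v; rewrite -(meval_eq _ (pt_slices v)).
  rewrite -[RHS](T0 (fun i k => slices v k i i)) raddf_sum; apply: eq_bigr => a _ /=.
  by rewrite mevalZ meval_diag_monom.
apply/ffunP=> a; rewrite [RHS]ffunE -[RHS](mcoeff0 _ (diag_monom a)) -P0 raddf_sum /=.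
rewrite (bigD1 a) //= mcoeffZ mcoeffX eqxx mulr1 big1 ?addr0 // => b /negbTE ba.
by rewrite mcoeffZ mcoeffX (inj_eq (@diag_monom_inj p q)) ba mulr0.
Qed.

Lemma word_eval_inj (K : closedFieldType) p q (T U : tens (monom 2 q) p K) :
  (forall x, word_eval T x = word_eval U x) -> T = U.
Proof.
move=> TU; apply/subr0_eq/word_eval_eq0 => x.
by rewrite word_evalB TU subrr.
Qed.

(** * Restriction of invariants to diagonal pairs *)

Section DiagPart.
Variables (K : closedFieldType) (n k : nat).
Hypothesis n_gt0 : (0 < n)%N.
Variable f : {mpoly K[n * n * 2]}.
Hypothesis f_homog : f \is (n * k).-homog.
Hypothesis f_inv : sl_invariant f.

Definition diag_pt (x : 'I_n -> 'I_2 -> K) := pt (fun s => diag_mx (\row_i x i s)).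

(** At a diagonal pair only monomials in diagonal entries contribute; by [row_degree] they have
    degree [k] in each position, so they come from words. *)
Lemma word_eval_diag_part x : word_eval (diag_part k f) x = f.@[diag_pt x].
Proof.
pose M (m : 'X_{1..n * n * 2}) := \prod_t diag_pt x t ^+ m t.
rewrite mevalE big_seq; transitivity (\sum_(m <- msupp f)
    \sum_(a : {ffun 'I_n -> monom 2 k} | diag_monom a == m) f@_m * M m); last first.
  rewrite big_seq; apply: eq_bigr => m mf.
  have [/existsP [a /eqP <-]|no] :=
      boolP [exists a : {ffun 'I_n -> monom 2 k}, diag_monom a == m].
    rewrite (big_pred1 a) // => b; exact: (inj_eq (@diag_monom_inj n k)).
  rewrite [LHS]big_pred0 => [|a]; last first.
    by apply/negbTE; apply: contra no => ?; apply/existsP; exists a.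
  suff : M m = 0 by rewrite /M => ->; rewrite mulr0.
  apply/eqP; apply: contraR no => /prodf_neq0 M0; apply/existsP.
  have off i j s : i != j -> m (idx i j s) = 0%N.
    move=> ij; have := M0 (idx i j s) isT; rewrite /diag_pt ptE !mxE (negbTE ij).
    by rewrite expr0n; case: (m _) => //=; rewrite eqxx.
  pose a0 i : 'X_{1..2} := [multinom m (idx i i s) | s < 2].
  have a0d i : mdeg (a0 i) = k.
    rewrite -(row_degree n_gt0 f_homog f_inv i mf) mdegE (bigD1 i) //=.
    rewrite [X in (_ + X)%N]big1 ?addn0.
      by apply: eq_bigr => s _; rewrite mnmE.
    by move=> j ji; rewrite big1 // => s _; rewrite off // eq_sym.
  have a0b i : (mdeg (a0 i) < k.+1)%N by rewrite a0d.
  have a0e i : mdeg (BMultinom (a0b i)) == k by apply/eqP/a0d.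
  exists [ffun i => exist _ (BMultinom (a0b i)) (a0e i)].
  apply/eqP/mnmP=> t; case: (idxP t) => i j s; rewrite mnmE !idxE ffunE /=.
  by case: eqVneq => [<-|ij]; rewrite ?mnmE // off.
under [RHS]eq_bigr => m _ do rewrite big_mkcond.
rewrite exchange_big; apply: eq_bigr => a _ /=.
rewrite ffunE -big_mkcond.
have -> : \prod_i 'X_[val (a i)].@[x i] = M (diag_monom a).
  rewrite /M /diag_pt -mevalX meval_diag_monom; apply: eq_bigr => i _.
  by apply: meval_eq => s; rewrite !mxE eqxx.
have [ma|] := boolP (diag_monom a \in msupp f); last first.
  move=> na; rewrite (memN_msupp_eq0 na) mul0r big_seq_cond big_pred0 // => m.
  by apply/negbTE; apply: contra na => /andP [mf /eqP ->].
rewrite -big_filter (perm_big [:: diag_monom a]) ?big_seq1 //.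
apply: uniq_perm; rewrite ?filter_uniq // => m.
by rewrite mem_filter inE; case: eqVneq => [<-|]; rewrite ?ma.
Qed.

(** Conjugation by a permutation matrix permutes the diagonal, and its two determinants multiply to
    1. *)
Lemma diag_part_sym : diag_part k f \in symtens (monom 2 k) n K.
Proof.
apply/symtensP => s; apply: word_eval_inj => x; rewrite word_eval_perm.
rewrite !word_eval_diag_part.
pose P : 'M[K]_n := perm_mx s.
have dP : \det P * \det P^T = 1 by rewrite det_tr det_perm -signr_addb addbb.
have P0 : \det P != 0 by apply: contra_eq_neq dP => ->; rewrite mul0r eq_sym oner_neq0.
have PT0 : \det P^T != 0 by rewrite det_tr.
rewrite -[RHS]mul1r -(expr1n _ k) -dP -(semi_invariance n_gt0 f_homog f_inv) //.
apply: meval_eq => t; case: (idxP t) => i j r.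
rewrite /diag_pt !ptE -row_permE tr_perm_mx -col_permE !mxE.
by rewrite (inj_eq perm_inj).
Qed.

Lemma diag_part_eq0 : diag_part k f = 0 -> f = 0.
Proof.
move=> f0; apply: (diag_vanishing n_gt0 f_homog f_inv) => x.
transitivity (f.@[diag_pt (fun i s => x s 0 i)]).
  by apply: meval_eq => t; rewrite /diag_pt /pt !mxE.
rewrite -word_eval_diag_part f0 /word_eval big1 // => a _.
by rewrite ffunE mul0r.
Qed.
End DiagPart.

(** * Binary forms and their dehomogenisation *)

Section BinaryForms.
Variable n : nat.

Lemma mdeg2 (m : 'X_{1..2}) : mdeg m = (m 0%R + m 1%R)%N.
Proof. by rewrite mdegE big_ord_recl big_ord1; congr (_ + m _)%N; apply/val_inj. Qed.

Lemma monom2_deg (al : monom 2 n) : (val al 0%R + val al 1%R)%N = n.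
Proof. by rewrite -mdeg2; exact/eqP/(valP al). Qed.

Lemma ord_of_monom_subproof (al : monom 2 n) : (val al 0%R < n.+1)%N.
Proof. by rewrite ltnS; apply: leq_trans (leq_addr _ _) (eq_leq (monom2_deg al)). Qed.

Definition ord_of_monom al : 'I_n.+1 := Ordinal (ord_of_monom_subproof al).

Definition binary_exp (j : 'I_n.+1) : 'X_{1..2} :=
  [multinom if k == 0%R then j : nat else (n - j)%N | k < 2].

Lemma binary_exp_deg j : mdeg (binary_exp j) = n.
Proof. by rewrite mdeg2 !mnmE /= subnKC // -ltnS. Qed.

Lemma binary_exp_bound j : (mdeg (binary_exp j) < n.+1)%N.
Proof. by rewrite binary_exp_deg. Qed.

Lemma binary_exp_mdeg j : mdeg (BMultinom (binary_exp_bound j)) == n.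
Proof. by apply/eqP/binary_exp_deg. Qed.

Definition monom_of_ord j : monom 2 n :=
  exist _ (BMultinom (binary_exp_bound j)) (binary_exp_mdeg j).

Lemma monom_of_ordK : cancel monom_of_ord ord_of_monom.
Proof. by move=> j; apply/val_inj; rewrite /= mnmE. Qed.

Lemma ord_of_monomK : cancel ord_of_monom monom_of_ord.
Proof.
move=> al; do 2!apply/val_inj; apply/mnmP=> k; rewrite /= mnmE /=.
case: k => -[|[|//]] lt_k; first by congr (val al _); apply/val_inj.
have -> : Ordinal lt_k = 1 by apply/val_inj.
apply/eqP; rewrite -(eqn_add2l (val al 0%R)) monom2_deg /= subnKC //.
by rewrite -ltnS ord_of_monom_subproof.
Qed.

Definition affine_pt (R : fieldType) (t : R) (k : 'I_2) : R := if k == 0 then t else 1.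

Lemma meval_affine_pt (R : fieldType) (al : monom 2 n) (t : R) :
  'X_[val al].@[affine_pt t] = t ^+ ord_of_monom al.
Proof.
by rewrite mevalX big_ord_recl big_ord1 /= expr1n mulr1.
Qed.

(** Setting the second variable to 1 turns the form into a polynomial in [t] with the same
    coefficients. *)
Lemma binary_form_eq0 (K : closedFieldType) (c : monom 2 n -> K) :
  (forall t, \sum_al c al * 'X_[val al].@[affine_pt t] = 0) -> forall al, c al = 0.
Proof.
move=> c0; pose P := \poly_(j < n.+1) c (monom_of_ord (inord j)).
have P0 : P = 0.
  apply/eqP; apply: contraT => /closed_nonrootP [t]; case/negP; apply/eqP.
  rewrite horner_poly -[RHS](c0 t) (reindex monom_of_ord); last first.
    by exists ord_of_monom => ? _; rewrite ?monom_of_ordK ?ord_of_monomK.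
  apply: eq_bigr => j _; rewrite inord_val meval_affine_pt.
  by rewrite monom_of_ordK.
move=> al; have /(congr1 (fun p : {poly K} => p`_(ord_of_monom al))) := P0.
by rewrite coef0 coef_poly ltn_ord inord_val ord_of_monomK.
Qed.

Lemma binary_form_inj (K : closedFieldType) (c d : monom 2 n -> K) :
  (forall t, \sum_al c al * 'X_[val al].@[affine_pt t] =
     \sum_al d al * 'X_[val al].@[affine_pt t]) -> c =1 d.
Proof.
move=> cd al; apply/subr0_eq; move: al.
apply: binary_form_eq0 => t.
rewrite -[RHS](subrr (\sum_al d al * 'X_[val al].@[affine_pt t])).
by rewrite -{1}cd -sumrB; apply: eq_bigr => al _; rewrite mulrBl.
Qed.
End BinaryForms.

(** * Coefficients of the determinant of a pencil *)

Section PencilCoef.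
Variables (R : fieldType) (n : nat).

(* [\det (\sum_k s k *: X k)] is a binary form in [s]; these are its coefficients,
   as polynomials in the entries of [X]. *)
Definition pencil_coef (al : monom 2 n) : {mpoly R[n * n * 2]} :=
  \sum_(sg : 'S_n) \sum_(ka : {ffun 'I_n -> 'I_2} | content_monom ka == al)
    (-1) ^+ sg *: 'X_[content [ffun i => idx i (sg i) (ka i)]].

Lemma pencil_coef_homog al : pencil_coef al \is n.-homog.
Proof.
apply: rpred_sum => sg _; apply: rpred_sum => ka _; apply: dhomogZ.
by rewrite dhomogX /= mdeg_content.
Qed.

(** In the Leibniz expansion, [ka] records which matrix supplies the entry of each row; its content
    is the exponent of [s]. *)
Lemma pencil_coef_det (X : 'I_2 -> 'M[R]_n) s :
  \sum_al (pencil_coef al).@[pt X] * 'X_[val al].@[s] = \det (\sum_k s k *: X k).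
Proof.
transitivity (\sum_(sg : 'S_n) \sum_(ka : {ffun 'I_n -> 'I_2})
    (-1) ^+ sg * \prod_i (s (ka i) * X (ka i) i (sg i))).
  under eq_bigr => al _ do rewrite /pencil_coef raddf_sum mulr_suml.
  rewrite exchange_big; apply: eq_bigr => sg _ /=.
  rewrite [RHS](partition_big (@content_monom 2 n) xpredT) //=.
  apply: eq_bigr => al _; rewrite raddf_sum mulr_suml; apply: eq_bigr => ka /eqP <-.
  rewrite /= mevalZ !meval_content -mulrA; congr (_ * _).
  rewrite mulrC -big_split; apply: eq_bigr => i _ /=.
  by rewrite ffunE ptE.
apply: eq_bigr => sg _; rewrite -mulr_sumr; congr (_ * _).
rewrite -(bigA_distr_bigA (fun i k => s k * X k i (sg i))); apply: eq_bigr => i _ /=.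
by rewrite summxE; apply: eq_bigr => k _; rewrite !mxE.
Qed.

Definition coef_word p (a : {ffun 'I_p -> monom 2 n}) : {mpoly R[n * n * 2]} :=
  \prod_r pencil_coef (a r).

Lemma coef_word_homog p (a : {ffun 'I_p -> monom 2 n}) :
  coef_word a \is (n * p).-homog.
Proof.
rewrite /coef_word.
have -> : (n * p = \sum_(r < p) n)%N by rewrite sum_nat_const card_ord mulnC.
elim/big_rec2: _ => [|r q d _ hq]; first exact: dhomog1.
exact: dhomogM (pencil_coef_homog _) hq.
Qed.

Lemma coef_word_perm p (s : 'S_p) (a : {ffun 'I_p -> monom 2 n}) :
  coef_word [ffun r => a (s r)] = coef_word a.
Proof.
rewrite /coef_word [RHS](reindex_inj (@perm_inj _ s)).
by apply: eq_bigr => r _; rewrite ffunE.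
Qed.

Lemma meval_coef_word p (a : {ffun 'I_p -> monom 2 n}) v :
  (coef_word a).@[v] = \prod_r (pencil_coef (a r)).@[v].
Proof. exact: rmorph_prod. Qed.
End PencilCoef.

Lemma map_pencil_coef (F K : fieldType) (iota : {rmorphism F -> K}) n (al : monom 2 n) :
  map_mpoly iota (pencil_coef F al) = pencil_coef K al.
Proof.
rewrite raddf_sum; apply: eq_bigr => sg _; rewrite raddf_sum; apply: eq_bigr => ka _ /=.
by rewrite map_mpolyZ map_mpolyX rmorph_sign.
Qed.

Lemma map_coef_word (F K : fieldType) (iota : {rmorphism F -> K}) n p
    (a : {ffun 'I_p -> monom 2 n}) :
  map_mpoly iota (coef_word F a) = coef_word K a.
Proof. by rewrite rmorph_prod; apply: eq_bigr => r _; exact: map_pencil_coef. Qed.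

Section PencilCoefClosed.
Variables (K : closedFieldType) (n : nat).
Implicit Types (X : 'I_2 -> 'M[K]_n) (al : monom 2 n).

(** The determinant of the pencil ignores [z1] and [z2], while [g] substitutes linear forms for [s];
    coefficients are then compared. *)
Lemma pencil_coef_act z1 z2 g X al : \det z1 = 1 -> \det z2 = 1 ->
  (pencil_coef K al).@[pt (pencil_act z1 z2 g X)] =
  \sum_be sympow_mx g al be * (pencil_coef K be).@[pt X].
Proof.
move=> d1 d2; move: al; apply: binary_form_inj => t; rewrite pencil_coef_det.
set s := affine_pt t.
have -> : \sum_k s k *: pencil_act z1 z2 g X k =
    z1 *m (\sum_k' (\sum_k g k k' * s k) *: X k') *m z2^T.
  rewrite mulmx_sumr mulmx_suml; under eq_bigr => k _ do rewrite scaler_sumr.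
  rewrite exchange_big; apply: eq_bigr => k' _ /=.
  rewrite -scalemxAr -scalemxAl scaler_suml; apply: eq_bigr => k _.
  by rewrite scalerA mulrC.
rewrite !det_mulmx d1 det_tr d2 mul1r mulr1 -pencil_coef_det.
under [RHS]eq_bigr => al _ do rewrite mulr_suml.
rewrite exchange_big; apply: eq_bigr => be _ /=.
by rewrite -meval_sympow_mx mulr_sumr; apply: eq_bigr => al _; rewrite mulrCA mulrA.
Qed.

Lemma pencil_coef_inv al : sl_invariant (pencil_coef K al).
Proof.
move=> z1 z2 X d1 d2.
transitivity ((pencil_coef K al).@[pt (pencil_act z1 z2^T 1%:M X)]).
  by apply: meval_eq => t; rewrite /pt pencil_act1 trmxK.
rewrite pencil_coef_act ?det_tr // (bigD1 al) //= sympow_mx1 eqxx mul1r.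
by rewrite big1 ?addr0 // => be /negbTE ab; rewrite sympow_mx1 eq_sym ab mul0r.
Qed.

Lemma coef_word_inv p (a : {ffun 'I_p -> monom 2 n}) : sl_invariant (coef_word K a).
Proof.
move=> z1 z2 X d1 d2; rewrite !meval_coef_word; apply: eq_bigr => r _.
exact: pencil_coef_inv.
Qed.

(* A binary form with nonzero leading coefficient is a product of linear forms,
   i.e. the determinant of a pencil of diagonal matrices. *)
Lemma pencil_coef_diag_surj (c : monom 2 n -> K) : (0 < n)%N ->
    c (monom_of_ord ord_max) != 0 ->
  exists x, forall al, (pencil_coef K al).@[diag_pt x] = c al.
Proof.
move=> n_gt0 c0; pose P := \poly_(j < n.+1) c (monom_of_ord (inord j)).
have c0' : c (monom_of_ord (inord n)) != 0.
  by rewrite (_ : inord n = ord_max) //; apply/val_inj; rewrite /= inordK.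
have szP : size P = n.+1 by rewrite size_poly_eq.
have lP : lead_coef P = c (monom_of_ord (inord n)).
  by rewrite lead_coefE szP coef_poly ltnSn.
have [r rP] := closed_field_poly_normal P.
have szr : size r = n.
  apply/eqP; rewrite -eqSS -szP rP size_scale ?lead_coef_eq0 -?size_poly_eq0 ?szP //.
  by rewrite size_prod_XsubC.
set lc := lead_coef P in rP; clearbody lc.
pose i0 : 'I_n := Ordinal n_gt0.
pose u (i : 'I_n) := if i == i0 then lc else 1.
(* Position [i] carries the linear factor of the [i]-th root; [u] puts the leading coefficient into
   position [i0]. *)
exists (fun i k => u i * (if k == 0 then 1 else - r`_i)).
apply: binary_form_inj => t; rewrite pencil_coef_det.
have -> : \sum_al c al * 'X_[val al].@[affine_pt t] = P.[t].
  rewrite horner_poly (reindex (@monom_of_ord n)); last first.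
    by exists (@ord_of_monom n) => ? _; rewrite ?monom_of_ordK ?ord_of_monomK.
  by apply: eq_bigr => j _; rewrite inord_val meval_affine_pt monom_of_ordK.
rewrite rP hornerZ horner_prod [in RHS](big_nth 0) szr big_mkord.
rewrite big_ord_recl big_ord1 /affine_pt /= scale1r.
have -> : lc = \prod_i u i.
  by rewrite (bigD1 i0) //= /u eqxx big1 ?mulr1 // => i /negbTE ->.
rewrite -big_split /=.
set M := (X in \det X); have -> : M = diag_mx (\row_i (u i * (t - r`_i))).
  apply/matrixP=> i j; rewrite !mxE; case: (i == j); rewrite ?mulr0 ?addr0 ?mulr1n //.
  by rewrite mulr1 mulrN mulrBr mulrC.
by rewrite det_diag; apply: eq_bigr => i _; rewrite mxE !hornerE.
Qed.
End PencilCoefClosed.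

(** * Sorted words, and independence of the products of coefficients *)

Section SortedWords.
Variables p q : nat.

(* Representatives of the [S_p]-orbits of words of length [p]. *)
Definition sorted_word := {t : p.-tuple 'I_q.+1 | sorted leq (map val t)}.

Lemma card_sorted_word : #|{: sorted_word}| = 'C(p + q, p).
Proof. by rewrite card_sig -card_sorted_tuples cardsE. Qed.

Definition word_of (t : sorted_word) : {ffun 'I_p -> monom 2 q} :=
  [ffun r => monom_of_ord (tnth (val t) r)].

Lemma sorted_word_exists (a : {ffun 'I_p -> monom 2 q}) :
  exists t (s : 'S_p), word_of t = [ffun r => a (s r)].
Proof.
pose u := [tuple ord_of_monom (a r) | r < p].
pose leqv := relpre (val : 'I_q.+1 -> nat) leq.
have so : sorted leq (map val (sort_tuple leqv u)).
  by rewrite sorted_map; apply: sort_sorted => x y; exact: leq_total.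
have /tuple_permP [s us] : perm_eq (sort_tuple leqv u) u by rewrite perm_sort.
exists (exist _ (sort_tuple leqv u) so), s; apply/ffunP => r; rewrite !ffunE /=.
have /val_inj/(congr1 (fun v : p.-tuple _ => tnth v r)) := us.
by rewrite !tnth_mktuple => ->; rewrite ord_of_monomK.
Qed.

Lemma symtens_sorted_eq (R : fieldType) (T U : tens (monom 2 q) p R) :
    T \in symtens (monom 2 q) p R -> U \in symtens (monom 2 q) p R ->
  (forall t, T (word_of t) = U (word_of t)) -> T = U.
Proof.
move=> /symtensP sT /symtensP sU TU; apply/ffunP => a.
have [t [s ta]] := sorted_word_exists a.
by have := TU t; rewrite ta -{2}(sT s) -{2}(sU s) !ffunE.
Qed.

Lemma sorted_content_inj (t u : sorted_word) :
  content (finfun (tnth (val t))) = content (finfun (tnth (val u))) -> t = u.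
Proof.
move=> tu; apply/val_inj/val_inj/(inj_map val_inj).
apply: (sorted_eq leq_trans anti_leq (valP t) (valP u)); apply: perm_map.
have E (v : sorted_word) : [tuple finfun (tnth (val v)) k | k < p] = val v.
  by apply/eq_from_tnth => r; rewrite tnth_mktuple ffunE.
by apply/allP => i _; rewrite /= -[val t]E -[val u]E -!contentE tu.
Qed.
End SortedWords.

(** By [pencil_coef_diag_surj], a relation gives a polynomial [P] in the coefficients of a binary
    form that vanishes wherever the leading one is nonzero, so [P = 0]. Distinct sorted words have
    distinct contents, so the [c t] are the coefficients of [P]. *)
Lemma sorted_coef_words_free (K : closedFieldType) n p (c : sorted_word p n -> K) :
    (0 < n)%N ->
    (forall x, \sum_t c t * (coef_word K (word_of t)).@[diag_pt x] = 0) ->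
  forall t, c t = 0.
Proof.
move=> n_gt0 c0; pose P : {mpoly K[n.+1]} :=
  \sum_t c t *: 'X_[content (finfun (tnth (val t)))].
have P0 : P = 0.
  suff : P * 'X_ord_max = 0.
    move/eqP; rewrite mulf_eq0 => /orP [/eqP //|/eqP/(congr1 (meval (fun=> 1)))].
    by rewrite mevalXU meval0 => /eqP; rewrite oner_eq0.
  apply: meval_eq0 => v; rewrite mevalM mevalXU.
  have [->|v0] := eqVneq (v ord_max) 0; first by rewrite mulr0.
  have [|x xE] := @pencil_coef_diag_surj K n (fun al => v (ord_of_monom al)) n_gt0.
    by rewrite monom_of_ordK.
  rewrite -[P.@[v]](_ : 0 = _) ?mul0r // -(c0 x) raddf_sum; apply: eq_bigr => t _ /=.
  rewrite mevalZ meval_content meval_coef_word; congr (_ * _).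
  by apply: eq_bigr => r _; rewrite !ffunE xE monom_of_ordK.
move=> t; rewrite -(mcoeff0 _ (content (finfun (tnth (val t))))) -P0 raddf_sum /=.
rewrite (bigD1 t) //= mcoeffZ mcoeffX eqxx mulr1 big1 ?addr0 // => u ut.
rewrite mcoeffZ mcoeffX; case: eqP => [/sorted_content_inj utE|]; last by rewrite mulr0.
by rewrite utE eqxx in ut.
Qed.

(** * Bijectivity of the restriction to the diagonal *)

Section DiagPartOverF.
Variables (F : fieldType) (K : closedFieldType) (iota : {rmorphism F -> K}).
Variables (n k : nat).
Hypothesis n_gt0 : (0 < n)%N.

(** Sorted words suffice, as [coef_word] is unchanged by permuting the word. *)
Definition coef_comb (R : fieldType) (c : sorted_word k n -> R) : {mpoly R[n * n * 2]} :=
  \sum_t c t *: coef_word R (word_of t).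

Lemma coef_comb_homog (R : fieldType) (c : sorted_word k n -> R) :
  coef_comb c \is (n * k).-homog.
Proof. by apply: rpred_sum => t _; apply: dhomogZ; exact: coef_word_homog. Qed.

Lemma coef_comb_inv (c : sorted_word k n -> K) : sl_invariant (coef_comb c).
Proof.
move=> z1 z2 X d1 d2; rewrite !raddf_sum; apply: eq_bigr => t _ /=.
by rewrite !mevalZ coef_word_inv.
Qed.

Lemma map_coef_comb (c : sorted_word k n -> F) :
  map_mpoly iota (coef_comb c) = coef_comb (iota \o c).
Proof.
rewrite raddf_sum; apply: eq_bigr => t _.
by rewrite /= map_mpolyZ map_coef_word.
Qed.

Lemma tens_emb_diag_part (f : {mpoly F[n * n * 2]}) :
  tens_emb iota (diag_part k f) = diag_part k (map_mpoly iota f).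
Proof. by apply/ffunP => a; rewrite !ffunE mcoeff_map_mpoly. Qed.

Lemma tens_emb_inj (I : finType) d : injective (@tens_emb I d F K iota).
Proof.
move=> T U TU; apply/ffunP=> a; apply: (fmorph_inj iota).
by have /ffunP/(_ a) := TU; rewrite !ffunE.
Qed.

Lemma tens_emb_symE (I : finType) d (T : tens I d F) :
  (tens_emb iota T \in symtens I d K) = (T \in symtens I d F).
Proof.
apply/idP/idP => [/symtensP sT|]; last exact: tens_emb_sym.
apply/symtensP=> s; apply: tens_emb_inj; rewrite -[RHS](sT s).
by apply/ffunP=> a; rewrite !ffunE.
Qed.

Lemma diag_part_sym_over (f : {mpoly F[n * n * 2]}) :
    f \is (n * k).-homog -> sl_invariant (map_mpoly iota f) ->
  diag_part k f \in symtens (monom 2 k) n F.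
Proof.
move=> fh fi; rewrite -tens_emb_symE tens_emb_diag_part.
by apply: diag_part_sym => //; exact: map_mpoly_homog.
Qed.

Lemma diag_part_coef_comb_sym (c : sorted_word k n -> F) :
  diag_part k (coef_comb c) \in symtens (monom 2 k) n F.
Proof.
apply: diag_part_sym_over; first exact: coef_comb_homog.
by rewrite map_coef_comb; exact: coef_comb_inv.
Qed.

Lemma diag_part_coef_comb_eq0 (c : sorted_word k n -> F) :
  diag_part k (coef_comb c) = 0 -> forall t, c t = 0.
Proof.
move=> c0 t; apply: (fmorph_inj iota); rewrite rmorph0; move: t.
apply: (sorted_coef_words_free n_gt0) => x.
transitivity (coef_comb (iota \o c)).@[diag_pt x].
  by rewrite raddf_sum; apply: eq_bigr => t _; rewrite /= mevalZ.
rewrite -(word_eval_diag_part n_gt0 (coef_comb_homog _) (@coef_comb_inv _)).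
rewrite -map_coef_comb -tens_emb_diag_part c0 /word_eval big1 // => a _.
by rewrite !ffunE rmorph0 mul0r.
Qed.

(* Restriction to the diagonal embeds the span of the [coef_word]s into the
   symmetric tensors; both have dimension ['C(n + k, n)]. *)
Lemma diag_part_surj (T : tens (monom 2 k) n F) : T \in symtens (monom 2 k) n F ->
  exists c, diag_part k (coef_comb c) = T.
Proof.
move=> sT; pose S := {: sorted_word k n}; pose S' := {: sorted_word n k}.
pose M : 'M[F]_(#|S|, #|S'|) := \matrix_(i, j)
  diag_part k (coef_word F (word_of (enum_val i))) (word_of (enum_val j)).
have rowM (u : 'rV[F]_#|S|) j : (u *m M) 0 j =
    diag_part k (coef_comb (fun t => u 0 (enum_rank t))) (word_of (enum_val j)).
  rewrite mxE (linear_sum (diag_part k)) sum_ffunE /=.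
  rewrite (reindex (@enum_rank S)) /=; last first.
    by exists enum_val => ? _; rewrite ?enum_rankK ?enum_valK.
  by apply: eq_bigr => t _; rewrite linearZ [in RHS]ffunE mxE enum_rankK.
have freeM : row_free M.
  apply: inj_row_free => u uM; apply/rowP => i; rewrite mxE -[i]enum_valK.
  apply: (@diag_part_coef_comb_eq0 (fun t => u 0 (enum_rank t))).
  apply: symtens_sorted_eq; [exact: diag_part_coef_comb_sym | exact: rpred0 |].
  by move=> t; rewrite -[t]enum_rankK -rowM uM mxE ffunE.
(* The equality of ['C(k + n, k)] and ['C(n + k, n)] makes [M] square. *)
have fullM : row_full M.
  move: freeM; rewrite /row_free /row_full => /eqP ->.
  by rewrite !card_sorted_word addnC -bin_sub ?leq_addl // addnK addnC.
have [B BM] := row_fullP fullM.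
pose v : 'rV[F]_#|S'| := \row_j T (word_of (enum_val j)).
exists (fun t => (v *m B) 0 (enum_rank t)).
apply: symtens_sorted_eq => // [|t]; first exact: diag_part_coef_comb_sym.
by rewrite -[t]enum_rankK -rowM -mulmxA BM mulmx1 mxE.
Qed.
End DiagPartOverF.

Lemma sl_invariantB (K : fieldType) n (f g : {mpoly K[n * n * 2]}) :
  sl_invariant f -> sl_invariant g -> sl_invariant (f - g).
Proof. by move=> fi gi z1 z2 X d1 d2; rewrite !mevalB fi ?gi. Qed.

(** Some combination has the same diagonal part as [f]; the difference is an invariant with zero
    diagonal part, hence zero. *)
Lemma sl_invariant_coef_comb (K : closedFieldType) n k (f : {mpoly K[n * n * 2]}) :
    (0 < n)%N -> f \is (n * k).-homog -> sl_invariant f ->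
  exists c : sorted_word k n -> K, f = coef_comb c.
Proof.
move=> n_gt0 fh fi.
have [c cf] :=
  diag_part_surj (idfun : {rmorphism K -> K}) n_gt0 (diag_part_sym n_gt0 fh fi).
exists c; apply/subr0_eq/(@diag_part_eq0 K n k n_gt0).
- by apply: rpredB fh _; exact: coef_comb_homog.
- by apply: sl_invariantB fi _; exact: coef_comb_inv.
- by rewrite linearB /= cf subrr.
Qed.

(** * Isomorphisms of representations *)

Section GLRepIso.
Variables (F : fieldType) (n : nat).
Implicit Types U V W : glrep F n.

Lemma glrep_iso_inj_surj U V (f : U -> V) : linear f -> injective f ->
    (forall v, exists u, f u = v) ->
    (forall g, g \in unitmx -> forall u, f (ract g u) = ract g (f u)) ->
  glrep_iso U V.
Proof.
move=> fl fi fs fe; pose L := GRing.isLinear.Build F U V _ f fl.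
pose fL : {linear U -> V} := HB.pack f L.
exists fL; split=> //.
have fs' v : exists u, f u == v by have [u <-] := fs v; exists u.
have fK v : f (xchoose (fs' v)) = v by exact/eqP/(xchooseP (fs' v)).
by exists (fun v => xchoose (fs' v)) => [u|v]; [apply: fi|]; rewrite /= fK.
Qed.

Lemma glrep_iso_sym U V : glrep_iso U V -> glrep_iso V U.
Proof.
case=> f [[g fK gK] fe]; apply: (@glrep_iso_inj_surj _ _ g).
- by move=> c u v; apply: (can_inj fK); rewrite linearP !gK.
- exact: can_inj gK.
- by move=> u; exists (f u); exact: fK.
- by move=> h hu v; apply: (can_inj fK); rewrite fe // !gK.
Qed.

Lemma glrep_iso_trans U V W : glrep_iso U V -> glrep_iso V W -> glrep_iso U W.
Proof.
case=> f [fb fe] [g [gb ge]]; apply: (@glrep_iso_inj_surj _ _ (g \o f)).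
- by move=> c u v; rewrite /= !linearP.
- exact: inj_comp (bij_inj gb) (bij_inj fb).
- by move=> w; case: fb gb => f' _ f'K [g' _ g'K]; exists (f' (g' w)); rewrite /= f'K g'K.
- by move=> h hu u; rewrite /= fe // ge.
Qed.
End GLRepIso.

(** * Compatibility with extension of scalars *)

Lemma map_mpoly_fmorph_inj (F K : fieldType) (iota : {rmorphism F -> K}) N :
  injective (map_mpoly iota : {mpoly F[N]} -> {mpoly K[N]}).
Proof.
move=> p q pq; apply/mpolyP => mu; apply: (fmorph_inj iota).
by rewrite -!mcoeff_map_mpoly pq.
Qed.

Lemma map_sympow_mx (F K : fieldType) (iota : {rmorphism F -> K}) N d (g : 'M[F]_N)
    (a b : monom N d) :
  iota (sympow_mx g a b) = sympow_mx (map_mx iota g) a b.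
Proof.
have bh : 'X_[val b] \is [in F[N], d.-homog] by rewrite dhomogX; exact: valP b.
rewrite /sympow_mx -mcoeff_map_mpoly.
have /(congr1 (fun p : sympow N d K => (val p)@_(val a))) /= :=
  sympow_emb_map iota g (DHomog bh).
by rewrite map_mpolyX.
Qed.

Lemma tens_emb_map_sympow (F K : fieldType) (iota : {rmorphism F -> K}) q p
    (g : 'M[F]_2) (T : tens (monom 2 q) p F) :
  tens_emb iota (tens_map (@sympow_mx 2 q F g) T) =
  tens_map (@sympow_mx 2 q K (map_mx iota g)) (tens_emb iota T).
Proof.
apply/ffunP=> a; rewrite !ffunE rmorph_sum; apply: eq_bigr => b _.
rewrite !ffunE rmorphM rmorph_prod; congr (_ * _).
by apply: eq_bigr => i _; rewrite map_sympow_mx.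
Qed.

Lemma dhomog_mulC (R : fieldType) N d e (p : {mpoly R[N]}) :
  p \is (d * e).-homog -> p \is (e * d).-homog.
Proof. by rewrite mulnC. Qed.

Lemma sl_invariantP (K : closedFieldType) n (f : {mpoly K[n * n * 2]}) :
  sl_invariant f <-> forall z1 z2, \det z1 = 1 -> \det z2 = 1 ->
    mpoly_map (kron3 z1 z2 1%:M) f = f.
Proof.
have E z1 z2 X : (mpoly_map (kron3 z1 z2 1%:M) f).@[pt X] =
    f.@[pt (fun k => z1^T *m X k *m z2)].
  rewrite meval_kron3; apply: meval_eq => t.
  by rewrite /pt trmx1 pencil_act1 trmxK.
split=> [fi z1 z2 d1 d2|fi z1 z2 X d1 d2].
  apply: meval_inj => v; rewrite -!(meval_eq _ (pt_slices v)) E fi ?det_tr //.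
by rewrite -[in RHS](fi z1^T z2) ?det_tr // E trmxK.
Qed.

(** * The invariants as [Sym_m Sym^l] *)

Section Invariants.
Variables (F : fieldType) (K : closedFieldType) (iota : {rmorphism F -> K}).
Variables (l m : nat).
Hypothesis m_gt0 : (0 < m)%N.

Lemma invar_homog (u : invar iota m (l * m)) : val (val u) \is (m * l).-homog.
Proof. exact/dhomog_mulC/(valP (val u)). Qed.

Lemma invar_sl_invariant (u : invar iota m (l * m)) :
  sl_invariant (map_mpoly iota (val (val u))).
Proof.
apply/sl_invariantP => z1 z2 d1 d2; have /asboolP/(_ z1 z2 d1 d2) := valP u.
by move/(congr1 val).
Qed.

Definition invar_diag (u : invar iota m (l * m)) : divpow (monom 2 l) m F :=
  Subm (diag_part_sym_over m_gt0 (invar_homog u) (invar_sl_invariant u)).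

Lemma word_eval_invar_diag u x :
  word_eval (tens_emb iota (val (invar_diag u))) x =
  (map_mpoly iota (val (val u))).@[diag_pt x].
Proof.
rewrite tens_emb_diag_part; apply: word_eval_diag_part => //.
  exact: map_mpoly_homog (invar_homog u).
exact: invar_sl_invariant.
Qed.

(** The map is restriction to the diagonal. Equivariance is checked on values over [K]: on both
    sides [g] acts by its transpose on each pair of diagonal entries. *)
Lemma invar_iso : glrep_iso (invar_rep iota m (l * m)) (symsym_rep F m l).
Proof.
apply: (@glrep_iso_inj_surj _ _ (invar_rep iota m (l * m)) (symsym_rep F m l) invar_diag).
- by move=> c u v; apply/val_inj/ffunP => a; rewrite !ffunE mcoeffD mcoeffZ.
- move=> u v /(congr1 val) /= uv; apply/val_inj/val_inj/subr0_eq.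
  apply: (@map_mpoly_fmorph_inj _ _ iota); rewrite raddf0.
  apply: (@diag_part_eq0 K m l m_gt0).
  + by apply: map_mpoly_homog; rewrite rpredB ?invar_homog.
  + by rewrite raddfB; apply: sl_invariantB; exact: invar_sl_invariant.
  rewrite -tens_emb_diag_part linearB /= uv subrr.
  by apply/ffunP => a; rewrite !ffunE rmorph0.
- move=> T; have [c cT] := diag_part_surj iota m_gt0 (valP T).
  have ch : coef_comb c \is (l * m).-homog by exact: dhomog_mulC (coef_comb_homog c).
  have ci : DHomog ch \in invarF iota (n := m) (d := l * m).
    apply/asboolP => z1 z2 d1 d2; apply/val_inj; move: z1 z2 d1 d2; apply/sl_invariantP.
    by rewrite /= map_coef_comb; exact: coef_comb_inv.
  by exists (Subm ci); apply/val_inj.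
- move=> g _ u; apply/val_inj/(@tens_emb_inj _ _ iota)/word_eval_inj => x.
  rewrite word_eval_invar_diag tens_emb_map_sympow word_eval_map word_eval_invar_diag.
  have /(congr1 val) /= -> := sympow_emb_map iota (kron3 1%:M 1%:M g) (val u).
  rewrite map_kron3 !map_mx1 meval_kron3; apply: meval_eq => t.
  case: (idxP t) => i j k; rewrite /diag_pt !ptE /pencil_act summxE !mxE.
  rewrite -sumrMnl; apply: eq_bigr => k' _.
  by rewrite !trmx1 mul1mx mulmx1 !mxE mulrnAr.
Qed.
End Invariants.

(** * Contraction of symmetric tensors with pencil coefficients *)

Section Contraction.
Variables (R : fieldType) (l m : nat).

Definition contraction (T : tens 'I_(l * l * 2) (l * m) R) : tens (monom 2 l) m R :=
  [ffun a => pairing (coef_word R a) T].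

Lemma contraction_linear : linear contraction.
Proof. by move=> c T U; apply/ffunP => a; rewrite !ffunE; exact: pairing_linear. Qed.
HB.instance Definition _ :=
  GRing.isLinear.Build R (tens 'I_(l * l * 2) (l * m) R) (tens (monom 2 l) m R) _
    contraction contraction_linear.

Lemma contraction_sym T : contraction T \in symtens (monom 2 l) m R.
Proof. by apply/symtensP => s; apply/ffunP => a; rewrite !ffunE coef_word_perm. Qed.

Lemma contraction_tpow v a :
  contraction (tpow (l * m) v) a = \prod_r (pencil_coef R (a r)).@[v].
Proof. by rewrite ffunE pairing_tpow ?meval_coef_word //; exact: coef_word_homog. Qed.
End Contraction.

Lemma tens_emb_contraction (F K : fieldType) (iota : {rmorphism F -> K}) l m
    (T : tens 'I_(l * l * 2) (l * m) F) :
  tens_emb iota (contraction T) = contraction (tens_emb iota T).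
Proof.
apply/ffunP => a; rewrite !ffunE rmorph_sum; apply: eq_bigr => mu _.
by rewrite rmorphM ffunE -(map_coef_word iota) mcoeff_map_mpoly.
Qed.

Section ContractionClosed.
Variables (K : closedFieldType) (l m : nat).
Hypothesis l_gt0 : (0 < l)%N.
Local Notation W := (divpow 'I_(l * l * 2) (l * m) K).

(** Both sides are linear in [w], so pure powers suffice; there the contraction is a product of
    values of pencil coefficients, and [pencil_coef_act] applies to each factor. *)
Lemma contraction_act z1 z2 g (w : W) : \det z1 = 1 -> \det z2 = 1 ->
  contraction (val (div_act z1 z2 g w)) =
  tens_map (@sympow_mx 2 l K g) (contraction (val w)).
Proof.
move=> d1 d2; have /asboolP := divpow_dpow_span w.
elim=> [|c _ u [v ->] _ ih].
  rewrite !linear0; apply/ffunP => a; rewrite !ffunE big1 // => b _.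
  by rewrite ffunE mulr0.
rewrite linearP /= linearP /= ih linearP tens_map_linear; congr (_ *: _ + _).
apply/ffunP => a; rewrite [RHS]ffunE tens_map_tpow contraction_tpow /=.
under [RHS]eq_bigr => b _ do rewrite contraction_tpow -big_split.
rewrite -(bigA_distr_bigA (fun r be => sympow_mx g (a r) be * (pencil_coef K be).@[v])).
apply: eq_bigr => r _; under [RHS]eq_bigr => be _ do rewrite -(meval_eq _ (pt_slices v)).
rewrite -(pencil_coef_act g _ _ d1 d2); apply: meval_eq => t; rewrite -kron3_pt.
by apply: eq_bigr => s _; rewrite pt_slices.
Qed.

Lemma contraction_coinv_rel (w : W) : w \in lspan (@coinv_rel K l (l * m)) ->
  contraction (val w) = 0.
Proof.
move/asboolP; elim=> [|c _ u [z1 [z2 [v [d1 d2 ->]]]] _ ih]; first exact: linear0.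
rewrite /= linearP /= ih addr0 linearB /= contraction_act //.
rewrite (eq_tens_map _ (@sympow_mx1 2 l K)) tens_map1 subrr scaler0 //.
Qed.

(* A functional vanishing on [coinv_rel] is the pairing with an invariant
   polynomial, i.e. with a combination of [coef_word]s. *)
Lemma contraction_eq0 (w : W) : contraction (val w) = 0 ->
  w \in lspan (@coinv_rel K l (l * m)).
Proof.
move=> w0; apply: contraT => /divpow_lspan_separation [c [cI]].
rewrite -pairing_functional_poly ?(valP w) //; set f := functional_poly c.
have fh : f \is (l * m).-homog by exact: functional_poly_homog.
have fE v : f.@[v] = \sum_b c b * val (dpow (l * m) v) b.
  by rewrite -(pairing_tpow _ fh) pairing_functional_poly ?tpow_sym.
have fi : sl_invariant f.
  move=> z1 z2 X d1 d2; apply/subr0_eq.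
  (* Vanishing of the functional on this relation is invariance of [f] at the point [pt X]. *)
  have := cI (div_act z1 z2^T 1%:M (dpow (l * m) (pt X)) - dpow (l * m) (pt X)).
  move=> <-; last by exists z1, z2^T, (dpow (l * m) (pt X)); rewrite det_tr.
  rewrite !fE -sumrB; apply: eq_bigr => b _.
  rewrite linearB /= tens_map_tpow !ffunE mulrBr; congr (_ * _ - _).
  apply: eq_bigr => k _.
  by rewrite kron3_pt /pt pencil_act1 trmxK.
have [q ->] := sl_invariant_coef_comb l_gt0 fh fi.
rewrite pairing_suml big1 ?eqxx // => t _.
by have /ffunP/(_ (word_of t)) := w0; rewrite !ffunE => ->; rewrite mulr0.
Qed.
End ContractionClosed.

(** * The coinvariants as [Sym_m Sym^l] *)

Section Coinvariants.
Variables (F : fieldType) (K : closedFieldType) (iota : {rmorphism F -> K}).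
Variables (l m : nat).
Hypothesis l_gt0 : (0 < l)%N.
Local Notation W R := (divpow 'I_(l * l * 2) (l * m) R).

(** The [coef_word]s of sorted words are independent, even on the diagonal, so their coefficient
    matrix [M] has a right inverse, which yields a tensor with prescribed pairings. *)
Lemma contraction_surj (T : tens (monom 2 l) m F) : T \in symtens (monom 2 l) m F ->
  exists w : W F, contraction (val w) = T.
Proof.
move=> sT; pose S := {: sorted_word m l}; pose S' := {: monom (l * l * 2) (l * m)}.
pose mu_ (j : 'I_#|S'|) : monom (l * l * 2) (l * m) := enum_val j.
pose M : 'M[F]_(#|S|, #|S'|) := \matrix_(i, j)
  (coef_word F (word_of (enum_val i)))@_(val (mu_ j)).
have freeM : row_free M.
  apply: inj_row_free => u uM; apply/rowP => i; rewrite mxE -[i]enum_valK.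
  move: (enum_val i); apply: (@diag_part_coef_comb_eq0 _ _ iota _ _ l_gt0).
  rewrite (_ : coef_comb _ = 0) ?linear0 //.
  rewrite (homog_monomE (coef_comb_homog _)) big1 // => mu _.
  rewrite raddf_sum -[X in X *: _](_ : 0 = _) ?scale0r //.
  have /rowP/(_ (enum_rank mu)) := uM; rewrite !mxE => {1}<-.
  rewrite (reindex (@enum_rank S)) /=; last first.
    by exists enum_val => ? _; rewrite ?enum_rankK ?enum_valK.
  by apply: eq_bigr => t _; rewrite mxE /mu_ !enum_rankK mcoeffZ.
have [B MB] := row_freeP freeM.
pose y : 'cV[F]_#|S'| := B *m \col_i T (word_of (enum_val i)).
(* The value depends only on the content of the word, so [w] is symmetric. *)
pose w : tens 'I_(l * l * 2) (l * m) F := [ffun b => y (enum_rank (content_monom b)) 0].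
have sw : w \in symtens _ _ F.
  apply/symtensP => s; apply/ffunP => b; rewrite !ffunE; congr (y (enum_rank _) 0).
  by apply/eqP; rewrite content_monomE /= content_perm.
exists (Subm sw); apply: symtens_sorted_eq => //; first exact: contraction_sym.
move=> t; transitivity ((M *m y) (enum_rank t) 0); last first.
  by rewrite /y mulmxA MB mul1mx mxE enum_rankK.
rewrite ffunE mxE /pairing (reindex mu_) /=; last first.
  by exists (fun mu : monom _ _ => enum_rank mu) => ? _; rewrite /mu_ ?enum_rankK ?enum_valK.
by apply: eq_bigr => j _; rewrite [M _ _]mxE enum_rankK ffunE monom_wordK /mu_ enum_valK.
Qed.

Local Notation rel := (@coinv_rel K l (l * m)).

Lemma coinv_rep_exists (x : coinv iota l (l * m)) :
  exists v : W F, (val x : coinvK K l (l * m)) = lpi rel (divpow_emb iota v).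
Proof. exact/asboolP/(valP x). Qed.

Definition coinv_contraction (x : coinv iota l (l * m)) : divpow (monom 2 l) m F :=
  Subm (contraction_sym (val (projT1 (cid (coinv_rep_exists x))))).

(** Over [K] the kernel of the contraction is the span of the relations, and contraction commutes
    with the injective embedding of [F]-tensors. Hence [coinv_contraction] does not depend on the
    chosen representative. *)
Lemma contraction_lpi (u v : W F) :
  lpi rel (divpow_emb iota u) = lpi rel (divpow_emb iota v) <->
  contraction (val u) = contraction (val v).
Proof.
have E : contraction (val (divpow_emb iota u - divpow_emb iota v)) =
    tens_emb iota (contraction (val u) - contraction (val v)).
  rewrite linearB /= -!tens_emb_contraction.
  by apply/ffunP => a; rewrite !ffunE rmorphB.
split=> [/lpiP/contraction_coinv_rel|uv]; last first.
  apply/lpiP/(contraction_eq0 l_gt0); rewrite E uv subrr.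
  by apply/ffunP => a; rewrite !ffunE rmorph0.
rewrite E => uv; apply/subr0_eq/(@tens_emb_inj _ _ iota); rewrite uv.
by apply/ffunP => a; rewrite !ffunE rmorph0.
Qed.

Lemma coinv_contractionE (x : coinv iota l (l * m)) v :
    (val x : coinvK K l (l * m)) = lpi rel (divpow_emb iota v) ->
  val (coinv_contraction x) = contraction (val v).
Proof. by rewrite /=; case: cid => u /= -> /contraction_lpi. Qed.

Lemma contraction_act_over g (u : W F) :
  contraction (val (div_act 1%:M 1%:M g u)) =
  tens_map (@sympow_mx 2 l F g) (contraction (val u)).
Proof.
apply: (@tens_emb_inj _ _ iota); rewrite tens_emb_map_sympow !tens_emb_contraction.
rewrite -[LHS]/(contraction (val (divpow_emb iota (div_act 1%:M 1%:M g u)))).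
by rewrite div_act_emb !map_mx1 contraction_act ?det1.
Qed.

Lemma coinv_iso : glrep_iso (coinv_rep iota l (l * m)) (symsym_rep F m l).
Proof.
apply: (@glrep_iso_inj_surj _ _ (coinv_rep iota l (l * m)) (symsym_rep F m l)
  coinv_contraction).
- move=> c x y; have [u xu] := coinv_rep_exists x; have [v yv] := coinv_rep_exists y.
  apply/val_inj; rewrite (@coinv_contractionE _ (c *: u + v)).
    rewrite -[LHS]/(contraction (c *: val u + val v)) contraction_linear.
    by rewrite -(coinv_contractionE xu) -(coinv_contractionE yv).
  by rewrite divpow_embD [RHS]lpi_is_linear -xu -yv.
- move=> x y xy; have [u xu] := coinv_rep_exists x; have [v yv] := coinv_rep_exists y.
  apply/val_inj; rewrite [LHS]xu [RHS]yv; apply/contraction_lpi.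
  by rewrite -(coinv_contractionE xu) -(coinv_contractionE yv) xy.
- move=> T; have [w wT] := contraction_surj (valP T).
  have wF : lpi rel (divpow_emb iota w) \in @coinvF F K iota l (l * m).
    by apply/asboolP; exists w.
  exists (Subm wF); apply/val_inj; rewrite -[RHS]wT; exact: coinv_contractionE.
- move=> g _ x; have [u xu] := coinv_rep_exists x; apply/val_inj.
  rewrite (@coinv_contractionE _ (div_act 1%:M 1%:M g u)); last first.
    by rewrite /= [subm_val x]xu coinvK_actE div_act_emb !map_mx1.
  by rewrite contraction_act_over -(coinv_contractionE xu).
Qed.
End Coinvariants.

Theorem corollary4p4 (F : fieldType) (K : closedFieldType)
    (iota : {rmorphism F -> K}) (K_alg : forall x : K, algebraicOver iota x)
    (l m : nat) (l_ge1 : (1 <= l)%N) (m_ge1 : (1 <= m)%N) :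
  glrep_iso (coinv_rep iota l (l * m)) (symsym_rep F m l) /\
  glrep_iso (coinv_rep iota l (l * m)) (invar_rep iota m (l * m)).
Proof.
have coinv_symsym := @coinv_iso F K iota l m l_ge1.
split=> //; apply: glrep_iso_trans coinv_symsym _.
by apply: glrep_iso_sym; exact: invar_iso.
Qed.
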